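(* Let $S$ be a standard graded polynomial ring over a field $k$ and let $I\subset S$ be a homogeneous ideal of height $c\geq 2$, with $p=\mathrm{pdim}_S(S/I)$, that satisfies the condition $N_{d,q}$. Then $$\beta_t(S/I)\leq \binom{d+t-2}{t-1}\binom{d+p-1}{p-t}\quad\text{for } 2\leq t\leq q.$$
   Context: $\beta_i(S/I)=\dim_k\mathrm{Tor}_i^S(k,S/I)$. Write $t_i^S(N)=\sup\{j\mid \mathrm{Tor}_i^S(k,N)_j\neq0\}$. For integers $d,q\geq 1$, a homogeneous ideal $I$ satisfies the condition $N_{d,q}$ if $I$ is generated in the single degree $d$ and $t_i^S(S/I)=d+i-1$ for all $1\leq i\leq q$. *)

(* Defs.v *)
From HB Require Import structures.
From mathcomp Require Import all_boot all_order all_algebra.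
From mathcomp Require Import ring_quotient.
From mathcomp Require Import mpoly.

Set Implicit Arguments.
Unset Strict Implicit.
Unset Printing Implicit Defensive.

Import Order.TTheory GRing.Theory Num.Theory.

Local Open Scope ring_scope.
Local Open Scope quotient_scope.

(* [{ideal_quot I}] is only a ring in the library; here R/I is made an
   R-module, with a acting as multiplication by the class of a. *)
Section QuotientModule.
Variables (R : comNzRingType) (I : idealr R).

Definition quot_scale (a : R) (x : {ideal_quot I}) : {ideal_quot I} :=
  \pi_({ideal_quot I}) a * x.

Lemma quot_scaleA a b x : quot_scale a (quot_scale b x) = quot_scale (a * b) x.
Proof. by rewrite /quot_scale mulrA rmorphM. Qed.

Lemma quot_scale1 : left_id 1 quot_scale.
Proof. by move=> x; rewrite /quot_scale rmorph1 mul1r. Qed.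

Lemma quot_scaleDr : right_distributive quot_scale +%R.
Proof. by move=> a x y; rewrite /quot_scale mulrDr. Qed.

Lemma quot_scaleDl x : {morph quot_scale^~ x : a b / a + b}.
Proof. by move=> a b; rewrite /quot_scale rmorphD mulrDl. Qed.

HB.instance Definition _ := GRing.Zmodule_isLmodule.Build R {ideal_quot I}
  quot_scaleA quot_scale1 quot_scaleDr quot_scaleDl.
End QuotientModule.

Section Height.
Variable R : comNzRingType.

(* A chain Q 0 < Q 1 < ... < Q h = P of primes; values beyond h are ignored. *)
Definition prime_chain (P : prime_idealr R) (h : nat) : Prop :=
  exists Q : nat -> prime_idealr R,
    (forall i, (i < h)%N ->
       {subset Q i <= Q i.+1} /\ ~ {subset Q i.+1 <= Q i}) /\ Q h =i P.

Definition prime_height (P : prime_idealr R) (h : nat) : Prop :=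
  prime_chain P h /\ forall m, prime_chain P m -> (m <= h)%N.

(* The minimum of the heights of the primes containing I; since chains can be
   truncated from below, [prime_chain P c] says that P has height >= c. *)
Definition ideal_height (I : idealr R) (c : nat) : Prop :=
  (exists P : prime_idealr R, {subset I <= P} /\ prime_height P c) /\
  (forall P : prime_idealr R, {subset I <= P} -> prime_chain P c).
End Height.

Section Resolutions.
Variable R : nzRingType.

Definition projective (P : lmodType R) : Prop :=
  forall (A B : lmodType R) (g : {linear A -> B}) (f : {linear P -> B}),
    (forall b, exists a, g a = b) ->
    exists h : {linear P -> A}, forall x, g (h x) = f x.

Record resolution (N : lmodType R) (M : nat -> lmodType R) := Resolution {
  res_d : forall i, {linear M i.+1 -> M i};
  res_aug : {linear M 0%N -> N};
  res_aug_surj : forall y, exists x, res_aug x = y;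
  res_exact0 : forall x, res_aug x = 0 <-> exists y, x = res_d 0%N y;
  res_exactS : forall i x, res_d i x = 0 <-> exists y, x = res_d i.+1 y
}.

Definition projective_resolution_of_length (N : lmodType R) (p : nat) : Prop :=
  exists M : nat -> lmodType R,
    [/\ forall i, projective (M i),
        forall i, (p < i)%N -> forall x : M i, x = 0
      & inhabited (resolution N M)].

Definition pdim (N : lmodType R) (p : nat) : Prop :=
  projective_resolution_of_length N p /\
  forall l, projective_resolution_of_length N l -> (p <= l)%N.
End Resolutions.

Section Graded.
Variables (k : fieldType) (n : nat).
Local Notation S := {mpoly k[n]}.

(* The graded piece S_z, for z in Z; it is zero for z < 0. *)
Definition homog_int (z : int) (f : S) : bool :=
  match z with Posz e => f \is e.-homog | Negz _ => f == 0 end.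

Definition homogeneous_ideal (I : idealr S) : Prop :=
  forall f e, f \in I -> pihomog mdeg e f \in I.

Definition generated_in_degree (I : idealr S) (d : nat) : Prop :=
  forall f, f \in I ->
    exists m (a g : 'I_m -> S),
      (forall l, g l \in I /\ g l \is d.-homog) /\
      f = \sum_(l < m) a l * g l.

(* A (not necessarily minimal) resolution of S/I by graded free modules
   F_i = (+)_b S(- gdeg i b) of finite rank [rk i], with maps of degree 0.
   Elements of F_i are row vectors, and [delta_mx 0 b] is the b-th basis
   element, of degree [gdeg i b]. *)
Record graded_free_resolution (I : idealr S) := GradedFreeResolution {
  rk : nat -> nat;
  gdeg : forall i, 'I_(rk i) -> int;
  gres :> resolution ({ideal_quot I} : lmodType S)
            (fun i => 'rV[S]_(rk i) : lmodType S);
  gaug_homog : forall b, exists2 f : S, homog_int (gdeg b) f &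
    res_aug gres (delta_mx 0 b) = \pi_({ideal_quot I}) f;
  gd_homog : forall i (a : 'I_(rk i.+1)) (b : 'I_(rk i)),
    homog_int (gdeg a - gdeg b) (res_d gres i (delta_mx 0 a) 0 b)
}.

Section Tor.
Variables (I : idealr S) (F : graded_free_resolution I).

(* Tor_i^S(k, S/I) is the homology of k (x)_S F, where k = S/(x_1,...,x_n), so
   that tensoring with k keeps the constant coefficients of the matrices. *)
Definition kd (i : nat) : 'M[k]_(rk F i.+1, rk F i) :=
  \matrix_(a, b) (res_d F i (delta_mx 0 a) 0 b)@_0%MM.

Definition kcycles (i : nat) : 'M[k]_(rk F i) :=
  match i with 0 => 1%:M | j.+1 => kermx (kd j) end.

Definition kdegree (i : nat) (j : int) : 'M[k]_(rk F i) :=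
  diag_mx (\row_b (gdeg b == j)%:R).

(* dim_k Tor_i^S(k, S/I) *)
Definition betti (i : nat) : nat := (\rank (kcycles i) - \rank (kd i))%N.

(* dim_k Tor_i^S(k, S/I)_j *)
Definition graded_betti (i : nat) (j : int) : nat :=
  (\rank (kcycles i :&: kdegree i j)%MS - \rank (kd i :&: kdegree i j)%MS)%N.

(* t_i^S(S/I) = v, as a supremum in Z; no integer v qualifies when Tor_i = 0,
   the supremum of the empty set being -oo. *)
Definition is_t (i : nat) (v : int) : Prop :=
  (forall j, graded_betti i j <> 0%N -> j <= v) /\
  (forall w, (forall j, graded_betti i j <> 0%N -> j <= w) -> v <= w).

Definition condition_N (d q : nat) : Prop :=
  generated_in_degree I d /\
  forall i, (1 <= i <= q)%N -> is_t i (d + i - 1)%N%:Z.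
End Tor.
End Graded.

(* Main.v *)
(* Let [x] be the variables of [S]. The module [Tor_t(k, S/I)] is also the Koszul
   homology [H_t(x; S/I)]. As [I] has no element of degree [< d], the part of
   degree [d + t - 1] is, through the differential, the space [T] of Koszul
   cycles of exterior degree [t - 1] with coefficients in [I_d], and under
   [N_{d,q}] it is everything when [t <= q]. So the task is to bound [dim T].

   A projective resolution of length [p] gives [H_i(x; S/I) = 0] for [i > p]. If
   there are more than [p] variables, then [S/I] has no socle, so by McCoy's
   theorem the linear form [l = \sum_i y^(n-i) x_i] over [k[y]] is a nonzerodivisor
   on [S[y]/I[y]]. Eliminating the last variable by [l = 0] preserves the vanishing
   and is injective on [T]: an element of [I_d] divisible by [l] is [l] times an
   element of [I_(d-1) = 0]. Working over integral domains, this ends with at most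
   [p] variables.

   Then [T] is contained in the Koszul cycles with coefficients in [S_d], whose
   rank is that of the [t]-th syzygies of the [d]-th power of the maximal ideal in
   [p] variables, namely ['C(d+t-2, t-1) * 'C(d+p-1, p-t)]. *)
Require Import Defs.
From HB Require Import structures.
From mathcomp Require Import all_boot all_order all_algebra.
From mathcomp Require Import ring_quotient fraction.
From mathcomp Require Import freeg mpoly zify ring.

Set Implicit Arguments.
Unset Strict Implicit.
Unset Printing Implicit Defensive.

Import Order.TTheory GRing.Theory Num.Theory.

Local Open Scope ring_scope.
Local Open Scope quotient_scope.

(** The field [k] may be finite, so a regular linear form need not exist over [k]; this is why each
    elimination adjoins a fresh [y] to the coefficients. The bound is therefore proved as a
    statement on dependence: too many cycles satisfy a nontrivial relation. Such a relation found
    over [D[y]] yields one over [D], because the original cycles do not involve [y]. The vanishing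
    of homology above [p] plays the role of depth at least [n - p].

    The resolution [F] need not be minimal, so Tor is compared with Koszul homology by a zigzag
    through the Koszul chains with coefficients in the terms of [F], keeping track of degrees. A Tor
    class of index [t] and degree at most [d + t - 1] gives a chain with coefficients of degree at
    most [d - 1], whose boundary has its coefficients in [I], hence of degree exactly [d]. Only
    injectivity is used: if a combination of these boundaries is 0, the same combination of the
    chains is a cycle over [S], so a boundary over [S], and the combined Tor class is 0. *)

(* [Kz m M] is [M] tensored with the exterior algebra on [e_0, ..., e_(m-1)]: a
   pair [(a, b) : Kz m.+1 M] stands for [a + b /\ e_m]. The differential [dK X]
   is that of the Koszul complex of [X 0, ..., X (m-1)] on [M]. *)
Fixpoint Kz (R : comNzRingType) (m : nat) (M : lmodType R) : lmodType R :=
  if m is m'.+1 then (Kz m' M * Kz m' M)%type : lmodType R else M.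

Fixpoint dK (R : comNzRingType) (X : nat -> R) (m : nat) (M : lmodType R) :
    Kz m M -> Kz m M :=
  if m is m'.+1 then fun z => (dK X z.1 + X m' *: z.2, - dK X z.2)
  else fun=> 0.

Fixpoint Kmap (R R' : comNzRingType) (m : nat) (M : lmodType R)
    (N : lmodType R') (f : M -> N) : Kz m M -> Kz m N :=
  if m is m'.+1 then fun z => (Kmap f z.1, Kmap f z.2) else f.

(* [z] is homogeneous of exterior degree [i], with all its coefficients in [P]. *)
Fixpoint Kin (R : comNzRingType) (m : nat) (M : lmodType R) (i : nat) (P : M -> Prop) :
    Kz m M -> Prop :=
  if m is m'.+1 then
    fun z => Kin i P z.1 /\ (if i is i'.+1 then Kin i' P z.2 else z.2 = 0)
  else fun z => if i is 0%N then P z else z = 0.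

Definition zclosed (V : zmodType) (P : V -> Prop) :=
  P 0 /\ forall u v, P u -> P v -> P (u - v).

Section Complex.
Variables (R : comNzRingType) (X : nat -> R).
Implicit Type M : lmodType R.

Lemma dK_linear m M c (u v : Kz m M) : dK X (c *: u + v) = c *: dK X u + dK X v.
Proof.
elim: m u v => [|m IH] u v /=; first by rewrite scaler0 addr0.
congr pair; rewrite !IH; last by rewrite opprD -scalerN.
by rewrite scalerDr scalerA addrACA (mulrC (X m)) -scalerA -scalerDr.
Qed.

Lemma dKD m M (u v : Kz m M) : dK X (u + v) = dK X u + dK X v.
Proof. by have := dK_linear 1 u v; rewrite !scale1r. Qed.

Lemma dK0 m M : dK X (0 : Kz m M) = 0.
Proof. by apply: (addrI (dK X (0 : Kz m M))); rewrite -dKD !addr0. Qed.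

Lemma dKZ m M c (u : Kz m M) : dK X (c *: u) = c *: dK X u.
Proof. by have := dK_linear c u 0; rewrite dK0 !addr0. Qed.

Lemma dKN m M (u : Kz m M) : dK X (- u) = - dK X u.
Proof. by rewrite -scaleN1r dKZ scaleN1r. Qed.

Lemma dKB m M (u v : Kz m M) : dK X (u - v) = dK X u - dK X v.
Proof. by rewrite dKD dKN. Qed.

Lemma dK_sum m M (I : Type) (r : seq I) (P : pred I) (F : I -> Kz m M) :
  dK X (\sum_(i <- r | P i) F i) = \sum_(i <- r | P i) dK X (F i).
Proof. exact: (big_morph _ (@dKD m M) (dK0 _ _)). Qed.

Lemma dK_dK m M (u : Kz m M) : dK X (dK X u) = 0.
Proof.
elim: m u => [|m IH] u //=.
by rewrite dKD dKZ dKN !IH oppr0 add0r scalerN addrN oppr0.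
Qed.

Lemma Kin_sub m i M (P Q : M -> Prop) (z : Kz m M) :
  (forall u, P u -> Q u) -> Kin i P z -> Kin i Q z.
Proof.
move=> PQ; elim: m i z => [|m IH] [|i] z //=; first exact: PQ.
  by case=> ? ->; split=> //; apply: IH.
by case=> ? ?; split; apply: IH.
Qed.

Lemma Kin_and m i M (P Q : M -> Prop) (z : Kz m M) :
  Kin i P z -> Kin i Q z -> Kin i (fun u => P u /\ Q u) z.
Proof.
elim: m i z => [|m IH] [|i] z //=.
  by case=> ? ? [? _]; split=> //; apply: IH.
by case=> ? ? [? ?]; split; apply: IH.
Qed.

Lemma Kin0 m i M (P : M -> Prop) : P 0 -> Kin i P (0 : Kz m M).
Proof. by move=> P0; elim: m i => [|m IH] [|i] //=; split=> //; apply: IH. Qed.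

Lemma KinB m i M (P : M -> Prop) (u v : Kz m M) :
  zclosed P -> Kin i P u -> Kin i P v -> Kin i P (u - v).
Proof.
case=> P0 PB; elim: m i u v => [|m IH] [|i] u v //=.
- exact: PB.
- by move=> -> ->; rewrite subr0.
- by move=> [? ->] [? ->]; split; [apply: IH | rewrite subr0].
- by move=> [? ?] [? ?]; split; apply: IH.
Qed.

Lemma KinN m i M (P : M -> Prop) (u : Kz m M) :
  zclosed P -> Kin i P u -> Kin i P (- u).
Proof. by move=> cP Pu; rewrite -sub0r; apply: KinB => //; apply: Kin0; case: cP. Qed.

Lemma KinD m i M (P : M -> Prop) (u v : Kz m M) :
  zclosed P -> Kin i P u -> Kin i P v -> Kin i P (u + v).
Proof. by move=> cP Pu Pv; rewrite -(opprK v); apply: KinB => //; apply: KinN. Qed.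

Lemma KinZ m i M (P Q : M -> Prop) c (z : Kz m M) :
  (forall u, P u -> Q (c *: u)) -> Kin i P z -> Kin i Q (c *: z).
Proof.
move=> PQ; elim: m i z => [|m IH] [|i] z /=.
- exact: PQ.
- by move=> ->; rewrite scaler0.
- by case=> ? ->; split; [apply: IH | rewrite scaler0].
- by case=> ? ?; split; apply: IH.
Qed.

Lemma Kin_sum m i M (P : M -> Prop) (I : Type) (r : seq I) (F : I -> Kz m M) :
  zclosed P -> (forall j, Kin i P (F j)) -> Kin i P (\sum_(j <- r) F j).
Proof.
by move=> cP PF; elim/big_rec: _ => [|j u _]; [apply: Kin0; case: cP | apply: KinD].
Qed.

Lemma Kin_dK0 m M (P : M -> Prop) (z : Kz m M) : Kin 0 P z -> dK X z = 0.
Proof.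
elim: m z => [|m IH] z //= [] /IH -> ->.
by rewrite scaler0 dK0 oppr0 addr0.
Qed.

Lemma Kin_dK m i M (P Q : M -> Prop) (z : Kz m M) : zclosed Q ->
  (forall j u, (j < m)%N -> P u -> Q (X j *: u)) ->
  Kin i.+1 P z -> Kin i Q (dK X z).
Proof.
move=> cQ; elim: m i z => [|m IH] i z /= PQ.
  by case: i => [|i] _ //; case: cQ.
have {}IH i' (u : Kz m M) : Kin i'.+1 P u -> Kin i' Q (dK X u).
  by apply: IH => j v jm; apply: PQ; apply: ltnW.
case=> P1 P2; split.
  by apply: KinD => //; [apply: IH | apply: KinZ P2 => u; apply: PQ].
case: i P1 P2 => [|i] P1 P2; first by rewrite (Kin_dK0 P2) oppr0.
by apply: KinN => //; apply: IH.
Qed.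

End Complex.

Section Maps.
Variables (R R' : comNzRingType) (M : lmodType R) (N : lmodType R').
Variable f : M -> N.

Lemma Kmap_additive m : (forall u v, f (u + v) = f u + f v) ->
  forall u v : Kz m M, Kmap f (u + v) = Kmap f u + Kmap f v.
Proof. by move=> fD; elim: m => [|m IH] u v //=; rewrite !IH. Qed.

Lemma Kmap0 m : f 0 = 0 -> Kmap f (0 : Kz m M) = 0.
Proof. by move=> f0; elim: m => [|m IH] //=; rewrite !IH. Qed.

Lemma KmapZ m c c' : (forall u, f (c *: u) = c' *: f u) ->
  forall u : Kz m M, Kmap f (c *: u) = c' *: Kmap f u.
Proof. by move=> fZ; elim: m => [|m IH] u //=; rewrite !IH. Qed.

Lemma Kin_Kmap m i (P : M -> Prop) (Q : N -> Prop) (z : Kz m M) : f 0 = 0 ->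
  (forall u, P u -> Q (f u)) -> Kin i P z -> Kin i Q (Kmap f z).
Proof.
move=> f0 PQ; elim: m i z => [|m IH] [|i] z /=.
- exact: PQ.
- by move=> ->.
- by case=> ? ->; split; [apply: IH | apply: Kmap0].
- by case=> ? ?; split; apply: IH.
Qed.

Lemma Kin_lift m i (P : N -> Prop) (Q : M -> Prop) (z : Kz m N) : f 0 = 0 ->
  (forall v, P v -> exists2 u, Q u & f u = v) ->
  Kin i P z -> exists2 w : Kz m M, Kin i Q w & Kmap f w = z.
Proof.
move=> f0 PQ; elim: m i z => [|m IH] [|i] z /=.
- exact: PQ.
- by move=> ->; exists 0.
- case=> /IH [w Qw wE] z2; exists (w, 0) => //=.
  by rewrite wE Kmap0 // -z2 -surjective_pairing.
- case=> /IH [w Qw wE] /IH [w' Qw' wE']; exists (w, w') => //=.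
  by rewrite wE wE' -surjective_pairing.
Qed.

Lemma Kin_inj m i (P : M -> Prop) (z : Kz m M) :
  (forall u, P u -> f u = 0 -> u = 0) -> Kin i P z -> Kmap f z = 0 -> z = 0.
Proof.
move=> fP; elim: m i z => [|m IH] [|i] z //=; first exact: fP.
  by case: z => z1 z2 /= [/IH z1P ->] [] /z1P ->.
by case: z => z1 z2 /= [/IH z1P /IH z2P] [] /z1P -> /z2P ->.
Qed.

Lemma Kin_ker m i (P : M -> Prop) (z : Kz m M) :
  Kin i P z -> Kmap f z = 0 -> Kin i (fun u => P u /\ f u = 0) z.
Proof.
elim: m i z => [|m IH] [|i] z //=.
  by case=> ? ? [? _]; split=> //; apply: IH.
by case=> ? ? [? ?]; split; apply: IH.
Qed.

Lemma Kmap_ext m i (g : M -> N) (P : M -> Prop) (z : Kz m M) : f 0 = g 0 ->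
  (forall u, P u -> f u = g u) -> Kin i P z -> Kmap f z = Kmap g z.
Proof.
move=> fg0 fg; have K0 n : Kmap f (0 : Kz n M) = Kmap g 0.
  by elim: n => [|n IH] //=; rewrite IH.
elim: m i z => [|m IH] [|i] z /=.
- exact: fg.
- by move=> ->.
- by case=> /IH -> ->; rewrite K0.
- by case=> /IH -> /IH ->.
Qed.

Lemma Kmap_dK (X : nat -> R) (X' : nat -> R') m :
  (forall u v, f (u + v) = f u + f v) -> 
  (forall j u, (j < m)%N -> f (X j *: u) = X' j *: f u) ->
  forall z : Kz m M, Kmap f (dK X z) = dK X' (Kmap f z).
Proof.
move=> fD; have f0 : f 0 = 0 by apply: (addrI (f 0)); rewrite -fD !addr0.
have KD k (u v : Kz k M) := Kmap_additive fD u v.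
have KN n (u : Kz n M) : Kmap f (- u) = - Kmap f u.
  by apply: (addrI (Kmap f u)); rewrite -KD !addrN Kmap0.
elim: m => [|m IH] fX z //=.
rewrite KD KN !(KmapZ (c' := X' m)) => [|u]; last exact: fX.
have {}IH := IH (fun j u jm => fX j u (ltnW jm)).
by rewrite !IH.
Qed.

End Maps.

Lemma Kmap_decomp (R : comNzRingType) (M : lmodType R) (f g : M -> M) c m :
  (forall u, u = f u + c *: g u) ->
  forall z : Kz m M, z = Kmap f z + c *: Kmap g z.
Proof. by move=> fg; elim: m => [|m IH] //= -[a b]; congr pair; apply: IH. Qed.

Lemma KzZ_inj (R : comNzRingType) (M : lmodType R) c m :
  (forall u : M, c *: u = 0 -> u = 0) -> forall z : Kz m M, c *: z = 0 -> z = 0.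
Proof.
by move=> cI; elim: m => [|m IH] // [a b] [] /IH -> /IH ->.
Qed.

Section Exactness.
Variables (R : comNzRingType) (X : nat -> R) (M : lmodType R).
Variables (n : nat) (eps sh : nat -> M -> M) (P : int -> M -> Prop).
Hypothesis epsD : forall j u v, eps j (u + v) = eps j u + eps j v.
Hypothesis epsX : forall i j u, (i < j < n)%N -> eps j (X i *: u) = X i *: eps j u.
Hypothesis epsX0 : forall j u, (j < n)%N -> eps j (X j *: u) = 0.
Hypothesis epsE : forall j (u : M), (j < n)%N -> u = eps j u + X j *: sh j u.
Hypothesis sh0 : forall j, sh j 0 = 0.
Hypothesis Xinj : forall j (u : M), (j < n)%N -> X j *: u = 0 -> u = 0.
Hypothesis epsP : forall e j u, P e u -> P e (eps j u).
Hypothesis shP : forall e j u, P e u -> P (e - 1) (sh j u).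

(* Setting the last variable to 0 (the map [eps]) reduces a cycle to one in
   fewer variables, and [sh] divides the difference by the variable. *)
Lemma Koszul_exact m i e (z : Kz m M) : (m <= n)%N ->
  Kin i.+1 (P e) z -> dK X z = 0 ->
  exists2 w : Kz m M, Kin i.+2 (P (e - 1)) w & dK X w = z.
Proof.
elim: m i e z => [|m IH] i e z mn; first by move=> /= ->; exists 0.
case: z => a b [/= Pa Pb] [] /eqP; rewrite addr_eq0 => /eqP dab _.
have eps0 j : eps j 0 = 0 by apply: (addrI (eps j 0)); rewrite -epsD !addr0.
have epsN' (u : Kz m M) : Kmap (eps m) (- u) = - Kmap (eps m) u.
  apply: (addrI (Kmap (eps m) u)); rewrite -Kmap_additive // !addrN.
  exact: Kmap0.
have aE := Kmap_decomp (fun u => @epsE m u mn) a.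
have lemn := ltnW mn.
have daE : dK X (Kmap (eps m) a) = 0.
  rewrite -(Kmap_dK (X := X)) //; last first.
    by move=> j u jm; apply: epsX; rewrite jm.
  rewrite dab epsN' (KmapZ (c' := 0)) ?scale0r ?oppr0 // => u.
  by rewrite epsX0 // scale0r.
have [|w Pw wE] := IH i e (Kmap (eps m) a) lemn _ daE.
  by apply: Kin_Kmap Pa => // u; apply: epsP.
exists (w, Kmap (sh m) a) => /=.
  by split=> //; apply: Kin_Kmap Pa => // u; apply: shP.
(* The second component requires [b = - dK (sh a)]. Applying the differential to [aE] gives
   [X m *: (dK (sh a) + b) = 0], and [X m] acts injectively. *)
rewrite wE -aE; congr pair; apply/eqP; rewrite eq_sym -subr_eq0 opprK; apply/eqP.
have /(congr1 (@dK R X m M)) := aE; rewrite dKD daE add0r dKZ dab => /eqP.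
rewrite eq_sym -addr_eq0 -scalerDr addrC => /eqP.
by apply: KzZ_inj => u; apply: Xinj.
Qed.
End Exactness.

(** * Polynomials and exactness of the Koszul complex *)

(** Indexed by all of [nat], with 0 beyond [n], since [dK] takes a sequence and may use fewer
    exterior generators than there are variables. *)
Definition xvar (D : nzRingType) (n j : nat) : {mpoly D[n]} :=
  if insub j is Some i then 'X_(i : 'I_n) else 0.

(** One predicate for being homogeneous ([eq d]), of order at least [d] ([leq d]) or of bounded
    degree; 0 satisfies each of them. *)
Definition degs (D : nzRingType) (n : nat) (Q : nat -> Prop) (f : {mpoly D[n]}) :=
  forall m, f@_m != 0 -> Q (mdeg m).

Definition setX0 (D : nzRingType) n j (f : {mpoly D[n]}) : {mpoly D[n]} :=
  \sum_(m <- msupp f | nth 0%N m j == 0%N) f@_m *: 'X_[m].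

Definition divX (D : nzRingType) n j (f : {mpoly D[n]}) : {mpoly D[n]} :=
  if insub j is Some i then
    \sum_(m <- msupp f | m i != 0%N) f@_m *: 'X_[m - U_(i : 'I_n)]
  else 0.

Section Degrees.
Variables (D : comNzRingType) (n : nat).
Implicit Types (f g : {mpoly D[n]}) (Q : nat -> Prop).

Lemma xvarE (i : 'I_n) : xvar D n i = 'X_i.
Proof. by rewrite /xvar valK. Qed.

Lemma mcoeffXM (i : 'I_n) f m :
  ('X_i * f)@_m = if m i == 0%N then 0 else f@_(m - U_(i)).
Proof.
case: ifPn => [/eqP mi|mi].
  apply: memN_msupp_eq0; apply/negP; rewrite mulrC (perm_mem (msuppMX _ _)).
  by case/mapP=> m' _ mE; move: mi; rewrite mE mnmDE mnm1E eqxx.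
by rewrite -{1}(submK (m := U_(i)) (m' := m)) ?lep1mP // mulrC addmC mcoeffMX.
Qed.

Lemma mcoeff_setX0 (i : 'I_n) f m :
  (setX0 i f)@_m = if m i == 0%N then f@_m else 0.
Proof.
rewrite /setX0 raddf_sum /= big_mkcond /=.
under eq_bigr do rewrite mcoeffZ mcoeffX.
have [fm|fm] := boolP (m \in msupp f).
  rewrite (bigD1_seq m) ?msupp_uniq //= -mnm_nth eqxx mulr1 big1 ?addr0 // => m' /negPf ->.
  by rewrite mulr0 if_same.
rewrite (memN_msupp_eq0 fm) if_same big1_seq // => m' /= fm'.
by case: (m' =P m) fm fm' => [-> /negPf ->|] //; rewrite mulr0 if_same.
Qed.

Lemma mcoeff_divX (i : 'I_n) f m : (divX i f)@_m = f@_(m + U_(i)).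
Proof.
rewrite /divX valK raddf_sum /= big_mkcond /=.
have mE (m' : 'X_{1..n}) : (if m' i != 0%N then (f@_m' *: 'X_[m' - U_(i)])@_m else 0)
    = f@_m' * (m' == m + U_(i))%MM%:R.
  rewrite mcoeffZ mcoeffX; case: ifPn => [m'i|/negPn/eqP m'i].
    congr (_ * (nat_of_bool _)%:R); apply/eqP/eqP => [<-|->]; last by rewrite addmK.
    by rewrite submK ?lep1mP.
  by case: eqP m'i => [->|]; rewrite ?mulr0 // mnmDE mnm1E eqxx addn1.
under eq_bigr do rewrite mE.
have [fm|fm] := boolP ((m + U_(i))%MM \in msupp f).
  rewrite (bigD1_seq (m + U_(i))%MM) ?msupp_uniq //= eqxx mulr1 big1 ?addr0 // => m' /negPf ->.
  by rewrite mulr0.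
rewrite (memN_msupp_eq0 fm) big1_seq // => m' /= fm'.
by case: (m' =P _) fm fm' => [-> /negPf ->|] //; rewrite mulr0.
Qed.

Lemma xvar_out j : (n <= j)%N -> xvar D n j = 0.
Proof. by move=> nj; rewrite /xvar insubF // ltnNge nj. Qed.

Lemma setX0_decomp j f : (j < n)%N -> f = setX0 j f + xvar D n j * divX j f.
Proof.
move=> jn; rewrite -[j]/(val (Ordinal jn)) xvarE; set i := Ordinal jn.
apply/mpolyP=> m; rewrite mcoeffD mcoeff_setX0 mcoeffXM mcoeff_divX.
by case: ifPn => mi; rewrite ?addr0 // add0r submK // lep1mP.
Qed.

Lemma setX0D j f g : (j < n)%N -> setX0 j (f + g) = setX0 j f + setX0 j g.
Proof.
move=> jn; rewrite -[j]/(val (Ordinal jn)); apply/mpolyP => m.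
by rewrite mcoeffD !mcoeff_setX0 mcoeffD; case: ifP; rewrite ?addr0.
Qed.

Lemma setX0_xvar j f : (j < n)%N -> setX0 j (xvar D n j * f) = 0.
Proof.
move=> jn; rewrite -[j]/(val (Ordinal jn)) xvarE; apply/mpolyP => m.
by rewrite mcoeff_setX0 mcoeffXM mcoeff0; case: (m _ == 0%N).
Qed.

Lemma setX0M i j f : (i < j < n)%N -> setX0 j (xvar D n i * f) = xvar D n i * setX0 j f.
Proof.
case/andP=> ij jn; have i_n := ltn_trans ij jn.
rewrite -[j]/(val (Ordinal jn)) -[i]/(val (Ordinal i_n)) !xvarE; apply/mpolyP => m.
rewrite mcoeff_setX0 !mcoeffXM mcoeff_setX0 mnmBE mnm1E -val_eqE /= (ltn_eqF ij) subn0.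
by case: ifP; case: ifP.
Qed.

Lemma setX00 j : setX0 j (0 : {mpoly D[n]}) = 0.
Proof. by rewrite /setX0 msupp0 big_nil. Qed.

Lemma divX0 j : divX j (0 : {mpoly D[n]}) = 0.
Proof. by rewrite /divX msupp0; case: insub => // i; rewrite big_nil. Qed.

Lemma xvar_inj j f : (j < n)%N -> xvar D n j * f = 0 -> f = 0.
Proof.
move=> jn; rewrite -[j]/(val (Ordinal jn)) xvarE => Xf; apply/mpolyP => m.
by have := mcoeffMX f U_(Ordinal jn) m; rewrite mulrC Xf !mcoeff0.
Qed.

Lemma degs_sub Q Q' f : (forall e, Q e -> Q' e) -> degs Q f -> degs Q' f.
Proof. by move=> QQ' Qf m /Qf; apply: QQ'. Qed.

Lemma degs_zclosed Q : zclosed (@degs D n Q).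
Proof.
split=> [m|f g Qf Qg m]; first by rewrite mcoeff0 eqxx.
rewrite mcoeffB; have [->|/Qf//] := eqVneq f@_m 0.
by rewrite sub0r oppr_eq0 => /Qg.
Qed.

Lemma degsM Q Q' Q'' f g : (forall a b, Q a -> Q' b -> Q'' (a + b)%N) ->
  degs Q f -> degs Q' g -> degs Q'' (f * g).
Proof.
move=> QQ Qf Qg m; rewrite -mcoeff_msupp => /msuppM_le /allpairsP [[m1 m2] /=].
rewrite !mcoeff_msupp => -[fm gm ->]; rewrite mdegD; apply: QQ.
  exact: Qf.
exact: Qg.
Qed.

Lemma degsZ Q c f : degs Q f -> degs Q (c *: f).
Proof.
by move=> Qf m; rewrite mcoeffZ => cf; apply: Qf; apply: contraNneq cf => ->; rewrite mulr0.
Qed.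

Lemma degsX m : degs (eq (mdeg m)) ('X_[m] : {mpoly D[n]}).
Proof. by move=> m'; rewrite mcoeffX; have [->|] := eqVneq m m'; rewrite ?eqxx. Qed.

Lemma degs_xvar j : degs (eq 1%N) (xvar D n j).
Proof.
rewrite /xvar; case: insub => [i|]; last by case: (degs_zclosed (eq 1%N)).
by rewrite -(mdeg1 i); apply: degsX.
Qed.

Lemma degsC c : degs (eq 0%N) (c%:MP : {mpoly D[n]}).
Proof.
rewrite -alg_mpolyC; apply: degsZ; rewrite -mpolyX0.
by have := @degsX 0%MM; rewrite mdeg0.
Qed.

Lemma degs_sum (I : Type) (r : seq I) (P : pred I) Q (F : I -> {mpoly D[n]}) :
  (forall i, P i -> degs Q (F i)) -> degs Q (\sum_(i <- r | P i) F i).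
Proof.
move=> QF; elim/big_rec: _ => [|i u Pi Qu]; first by case: (degs_zclosed Q).
have [Q0 QB] := degs_zclosed Q.
by rewrite -[u]opprK; apply: (QB); [apply: QF | rewrite -sub0r; apply: QB].
Qed.

Lemma degs_setX0 Q j f : (j < n)%N -> degs Q f -> degs Q (setX0 j f).
Proof.
move=> jn Qf m; rewrite -[j]/(val (Ordinal jn)) mcoeff_setX0.
by case: ifP => [_ /Qf|]; rewrite ?eqxx.
Qed.

Lemma degs_divX Q j f : (j < n)%N -> degs Q f -> degs (fun e => Q e.+1) (divX j f).
Proof.
move=> jn Qf m; rewrite -[j]/(val (Ordinal jn)) mcoeff_divX => /Qf.
by rewrite mdegD mdeg1 addn1.
Qed.

End Degrees.

Section CoordinateModule.
Variables (D : comNzRingType) (n : nat).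
Local Notation S := {mpoly D[n]}.
Variables (M : lmodType S) (A : Type) (c : A -> M -> S) (T : (S -> S) -> M -> M).
Hypothesis cD : forall a u v, c a (u + v) = c a u + c a v.
Hypothesis cZ : forall a s u, c a (s *: u) = s * c a u.
Hypothesis c_inj : forall u v, (forall a, c a u = c a v) -> u = v.
Hypothesis cT : forall t a u, t 0 = 0 -> c a (T t u) = t (c a u).
Variable Q : int -> A -> nat -> Prop.
Hypothesis QS : forall e a i, Q e a i.+1 -> Q (e - 1) a i.

Lemma coord_exact m i e (z : Kz m M) : (m <= n)%N ->
  Kin i.+1 (fun u => forall a, degs (Q e a) (c a u)) z -> dK (xvar D n) z = 0 ->
  exists2 w : Kz m M,
    Kin i.+2 (fun u => forall a, degs (Q (e - 1) a) (c a u)) w & dK (xvar D n) w = z.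
Proof.
move=> mn.
have c0 a : c a 0 = 0 by apply: (addrI (c a 0)); rewrite -cD !addr0.
pose eps j u := if (j < n)%N then T (@setX0 D n j) u else 0.
pose sh j u := if (j < n)%N then T (@divX D n j) u else 0.
have epsE j a u : (j < n)%N -> c a (eps j u) = setX0 j (c a u).
  by move=> jn; rewrite /eps jn cT // setX00.
have shE j a u : (j < n)%N -> c a (sh j u) = divX j (c a u).
  by move=> jn; rewrite /sh jn cT // divX0.
apply: (@Koszul_exact _ _ _ n eps sh (fun e u => forall a, degs (Q e a) (c a u)))
  => //.
- move=> j u v; have [jn|jn] := ltnP j n; last by rewrite /eps ltnNge jn addr0.
  by apply: c_inj => a; rewrite epsE // !cD !epsE // setX0D.
- move=> k j u /[dup] /andP[_ jn] kj; apply: c_inj => a.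
  by rewrite epsE // !cZ epsE // setX0M.
- by move=> j u jn; apply: c_inj => a; rewrite epsE // cZ c0 setX0_xvar.
- by move=> j u jn; apply: c_inj => a; rewrite cD cZ epsE // shE // -setX0_decomp.
- move=> j; have [jn|jn] := ltnP j n; last by rewrite /sh ltnNge jn.
  by apply: c_inj => a; rewrite shE // c0 divX0.
- move=> j u jn Xu; apply: c_inj => a; rewrite c0; apply: (xvar_inj jn).
  by rewrite -cZ Xu c0.
- move=> e' j u Qu a; have [jn|jn] := ltnP j n; first by rewrite epsE //; apply: degs_setX0.
  by rewrite /eps ltnNge jn c0; case: (degs_zclosed D n (Q e' a)).
- move=> e' j u Qu a; have [jn|jn] := ltnP j n.
    by rewrite shE //; apply: degs_sub (degs_divX jn (Qu a)) => k; apply: QS.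
  by rewrite /sh ltnNge jn c0; case: (degs_zclosed D n (Q (e' - 1) a)).
Qed.
End CoordinateModule.

(** * A generic linear form *)

(* Exterior multiplication by [\sum_(j < m) c j e_j], up to sign. *)
Fixpoint wedge (R : comNzRingType) (c : nat -> R) (m : nat) (M : lmodType R) :
    Kz m M -> Kz m M :=
  if m is m'.+1 then fun z => (wedge c z.1, c m' *: z.1 - wedge c z.2)
  else fun=> 0.

Section Wedge.
Variables (R : comNzRingType) (X c : nat -> R).
Implicit Type M : lmodType R.

Lemma wedge_linear m M a (u v : Kz m M) :
  wedge c (a *: u + v) = a *: wedge c u + wedge c v.
Proof.
elim: m u v => [|m IH] u v /=; first by rewrite scaler0 addr0.
congr pair; rewrite !IH //.
by rewrite scalerDr scalerA opprD addrACA (mulrC (c m)) -scalerA -scalerN -scalerDr.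
Qed.

Lemma wedgeD m M (u v : Kz m M) : wedge c (u + v) = wedge c u + wedge c v.
Proof. by have := wedge_linear 1 u v; rewrite !scale1r. Qed.

Lemma wedge0 m M : wedge c (0 : Kz m M) = 0.
Proof. by apply: (addrI (wedge c (0 : Kz m M))); rewrite -wedgeD !addr0. Qed.

Lemma wedgeZ m M a (u : Kz m M) : wedge c (a *: u) = a *: wedge c u.
Proof. by have := wedge_linear a u 0; rewrite wedge0 !addr0. Qed.

Lemma wedgeN m M (u : Kz m M) : wedge c (- u) = - wedge c u.
Proof. by rewrite -scaleN1r wedgeZ scaleN1r. Qed.

(** Exterior multiplication is a homotopy from multiplication by [\sum_i c i * X i] to 0; the change
    of basis in the elimination step rests on it. *)
Lemma dK_wedge m M (u : Kz m M) :
  dK X (wedge c u) + wedge c (dK X u) = (\sum_(i < m) c i * X i) *: u.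
Proof.
elim: m u => [|m IH] u /=; first by rewrite big_ord0 scale0r addr0.
case: u => a b; rewrite big_ord_recr /=; congr pair => /=.
  by rewrite wedgeD wedgeZ scalerBr scalerA addrACA IH subrK scalerDl (mulrC (X m)).
rewrite dKB dKZ wedgeN scalerDr scalerA opprK opprB -(addrA (c m *: _)).
by rewrite [LHS]addrA subrK addrCA IH scalerDl addrC.
Qed.

Lemma Kin_wedge m i M (P Q : M -> Prop) (z : Kz m M) : zclosed Q ->
  (forall j u, (j < m)%N -> P u -> Q (c j *: u)) ->
  Kin i P z -> Kin i.+1 Q (wedge c z).
Proof.
move=> cQ; elim: m i z => [|m IH] i z //= PQ.
have {}IH i' (u : Kz m M) : Kin i' P u -> Kin i'.+1 Q (wedge c u).
  by apply: IH => j v jm; apply: PQ; apply: ltnW.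
case=> P1 P2; split; first exact: IH.
apply: KinB => //; first by apply: KinZ P1 => u; apply: PQ.
case: i P1 P2 => [_ ->|i P1 P2]; last exact: IH.
by rewrite wedge0; apply: Kin0; case: cQ.
Qed.

End Wedge.

Fixpoint Ktop (R : comNzRingType) (m : nat) (M : lmodType R) (u : M) : Kz m M :=
  if m is m'.+1 then (0, Ktop m' u) else u.

Section KoszulMore.
Variables (R : comNzRingType) (X : nat -> R).
Implicit Type M : lmodType R.

Lemma Kin_top m M (P : M -> Prop) (u : M) : P 0 -> Kin m P (Ktop m u) <-> P u.
Proof. by move=> P0; elim: m => [|m IH] //=; split=> [[_ /IH]|/IH] //; split=> //; apply: Kin0. Qed.

Lemma Ktop_scale m M a (u : M) : a *: Ktop m u = Ktop m (a *: u).
Proof. by elim: m => [|m IH] //=; rewrite -IH; congr pair; rewrite scaler0. Qed.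

Lemma Kin_dK_top m M (P : M -> Prop) (u : M) : zclosed P ->
  (forall j, (j < m)%N -> P (X j *: u)) -> Kin m.-1 P (dK X (Ktop m u)).
Proof.
move=> cP; elim: m => [|m IH] PX; first by case: cP.
have {}IH := IH (fun j jm => PX j (ltnW jm)).
split; first by rewrite /= dK0 add0r Ktop_scale Kin_top; [apply: PX | case: cP].
by case: m IH {PX} => [|m] IH; [rewrite /= oppr0 | apply: KinN].
Qed.

Lemma Kin_large m i M (P : M -> Prop) (z : Kz m M) : (m < i)%N -> Kin i P z -> z = 0.
Proof.
elim: m i z => [|m IH] [|i] z //= mi; case: z => a b [/= /IH aE /IH bE].
by rewrite aE ?bE // ltnW.
Qed.

Lemma Kin_forall (R' : comNzRingType) (J : Type) (j0 : J) m i M (N : lmodType R')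
    (f : J -> M -> N) (P : M -> Prop) (Q : N -> Prop) (z : Kz m M) :
  Kin i P z -> (forall j, Kin i Q (Kmap (f j) z)) ->
  Kin i (fun u => forall j, Q (f j u)) z.
Proof.
elim: m i z => [|m IH] [|i] z //=.
  by case=> Pz ? Qz; split=> //; apply: IH => // j; case: (Qz j).
by case=> P1 P2 Qz; split; apply: IH => // j; case: (Qz j).
Qed.

Lemma Kin_scale_inv m i M (P Q : M -> Prop) c (z : Kz m M) :
  (forall u, Q (c *: u) -> P u) -> Kin i (fun=> True) z -> Kin i Q (c *: z) -> Kin i P z.
Proof.
move=> QP; elim: m i z => [|m IH] [|i] z //=; first by move=> _; apply: QP.
  by case=> ? ? [? _]; split=> //; apply: IH.
by case=> ? ? [? ?]; split; apply: IH.
Qed.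

Lemma Kmap_cancel (R' : comNzRingType) m M (N : lmodType R') (f : M -> N) (h : N -> M) :
  (forall u, f (h u) = u) -> forall z : Kz m N, Kmap f (Kmap h z) = z.
Proof. by move=> fh; elim: m => [|m IH] //= -[a b]; rewrite !IH. Qed.

Lemma Kmap_scale m M c (z : Kz m M) : Kmap (fun u => c *: u) z = c *: z.
Proof. by elim: m z => [|m IH] //= -[a b]; rewrite !IH. Qed.

Lemma Kin_divide m i M (P Q : M -> Prop) c (z : Kz m M) :
  (forall v, P v -> exists2 u, Q u & c *: u = v) ->
  Kin i P z -> exists2 w : Kz m M, Kin i Q w & c *: w = z.
Proof.
move=> PQ /(Kin_lift (f := fun u : M => c *: u) (Q := Q)) [] //; first exact: scaler0.
by move=> w Qw; rewrite Kmap_scale; exists w.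
Qed.

End KoszulMore.

(** Ideals are carried as predicates with these closure properties, together with [scaled], because
    this form survives both [exty] and [elim_image]. *)
Definition var_stable (D : nzRingType) n (I : {mpoly D[n]} -> Prop) :=
  zclosed I /\ forall j f, I f -> I (xvar D n j * f).

(** * Adjoining an indeterminate to the coefficients *)

Section PolyExtension.
Variables (D : comNzRingType) (n : nat).
Local Notation S := {mpoly D[n]}.
Local Notation Sy := {mpoly {poly D}[n]}.

Definition coefy j (F : Sy) : S := map_mpoly (coefp j) F.
Definition emby (f : S) : Sy := map_mpoly polyC f.
Definition ypow j : Sy := ('X^j)%:MP.

Lemma mcoeff_coefy j F m : (coefy j F)@_m = (F@_m)`_j.
Proof. exact: mcoeff_map_mpoly. Qed.

Lemma mcoeff_emby f m : (emby f)@_m = (f@_m)%:P.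
Proof. exact: mcoeff_map_mpoly. Qed.

Lemma coefyD j F G : coefy j (F + G) = coefy j F + coefy j G.
Proof. exact: raddfD. Qed.

Lemma coefyB j F G : coefy j (F - G) = coefy j F - coefy j G.
Proof. exact: raddfB. Qed.

Lemma coefy0 j : coefy j 0 = 0.
Proof. exact: raddf0. Qed.

Lemma embyD f g : emby (f + g) = emby f + emby g.
Proof. exact: raddfD. Qed.

Lemma emby0 : emby 0 = 0.
Proof. exact: raddf0. Qed.

Lemma emby_xvar i f : emby (xvar D n i * f) = xvar {poly D} n i * emby f.
Proof.
have [i_n|ni] := ltnP i n; last by rewrite !xvar_out // !mul0r emby0.
rewrite -[i]/(val (Ordinal i_n)) !xvarE; apply/mpolyP => m.
by rewrite mcoeffXM !mcoeff_emby mcoeffXM; case: ifP => //; rewrite mcoeff_emby.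
Qed.

Lemma coefy_xvar j i F : coefy j (xvar {poly D} n i * F) = xvar D n i * coefy j F.
Proof.
have [i_n|ni] := ltnP i n; last by rewrite !xvar_out // !mul0r coefy0.
rewrite -[i]/(val (Ordinal i_n)) !xvarE; apply/mpolyP => m.
rewrite mcoeffXM mcoeff_coefy !mcoeffXM; case: ifP => _; first by rewrite coef0.
by rewrite mcoeff_coefy.
Qed.

Lemma coefy_ypow j a F : coefy j (ypow a * F) = if (j < a)%N then 0 else coefy (j - a) F.
Proof.
apply/mpolyP => m; rewrite mcoeff_coefy mcoeffCM coefXnM.
by case: ifP => _; rewrite ?mcoeff0 // mcoeff_coefy.
Qed.

Lemma coefy_emby j f : coefy j (emby f) = if j == 0%N then f else 0.
Proof.
apply/mpolyP => m; rewrite mcoeff_coefy mcoeff_emby coefC.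
by case: ifP => _; rewrite ?mcoeff0.
Qed.

Lemma coefy_eventually0 F : exists r, forall j, (r <= j)%N -> coefy j F = 0.
Proof.
exists (\max_(m <- msupp F) size F@_m)%N => j rj; apply/mpolyP => m.
rewrite mcoeff_coefy mcoeff0; have [Fm|/memN_msupp_eq0 ->] := boolP (m \in msupp F).
  rewrite nth_default // (leq_trans _ rj) //.
  exact: (leq_bigmax_seq (F := fun m => size F@_m)).
by rewrite coef0.
Qed.

(* The extension of [I] to [D[y][x_0, ..., x_(n-1)]]; [coefy j] reads off the
   coefficient of [y^j]. *)
Definition exty (I : S -> Prop) (F : Sy) := forall j, I (coefy j F).

Lemma exty_var_stable I : var_stable I -> var_stable (exty I).
Proof.
case=> -[I0 IB] IX; do ?split.
- by move=> j; rewrite coefy0.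
- by move=> F G IF IG j; rewrite coefyB; apply: IB.
- by move=> i F IF j; rewrite coefy_xvar; apply: IX.
Qed.

Lemma exty_ypow I a F : var_stable I -> exty I F -> exty I (ypow a * F).
Proof. by case=> -[I0 _] _ IF j; rewrite coefy_ypow; case: ifP. Qed.

Lemma exty_emby I f : var_stable I -> I f -> exty I (emby f).
Proof. by case=> -[I0 _] _ If j; rewrite coefy_emby; case: ifP. Qed.

End PolyExtension.

Section McCoy.
Variables (D : comNzRingType) (n : nat) (I : {mpoly D[n.+1]} -> Prop).
Hypothesis subI : var_stable I.

(** The exponents of [y] are distinct, so the coefficients of this form in [y] are exactly the
    variables, as in McCoy's argument. The last exponent is 0, so the last variable has coefficient
    1 and can be eliminated over [D[y]]. *)
Definition moment_form : {mpoly {poly D}[n.+1]} :=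
  \sum_(i < n.+1) ypow D n.+1 (n - i) * xvar {poly D} n.+1 i.

(* McCoy's theorem on zero divisors in [M[y]], for [M = S/I]; the induction is on
   the degree in [y] of the part of [G] that is nonzero modulo [I]. *)
Lemma exty_regular G :
  (forall f, (forall i, (i < n.+1)%N -> I (xvar D n.+1 i * f)) -> I f) ->
  exty I (moment_form * G) -> exty I G.
Proof.
move=> soc; have [[I0 IB] IX] := subI.
have ID f g : I f -> I g -> I (f + g).
  by move=> If Ig; rewrite -[g]opprK; apply: (IB) => //; rewrite -sub0r; apply: IB.
have cfl j H : coefy j (moment_form * H) = \sum_(i < n.+1)
    (if (j < n - i)%N then 0 else xvar D n.+1 i * coefy (j - (n - i)) H).
  rewrite /moment_form mulr_suml (big_morph _ (@coefyD _ _ j) (@coefy0 _ _ j)).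
  apply: eq_bigr => i _; rewrite -mulrA coefy_ypow; case: ifP => // _.
  by rewrite coefy_xvar.
have step r : forall G, exty I (moment_form * G) ->
  (forall j, (r <= j)%N -> I (coefy j G)) -> exty I G.
  elim: r => [|r IHr] {}G lG rG; first by move=> j; apply: rG.
  have xr i : (i < n.+1)%N -> I (xvar D n.+1 i * coefy r G).
    elim/ltn_ind: i => i IHi i_n.
    have xG i' : (i' < i)%N -> exty I (xvar {poly D} n.+1 i' * G).
      move=> i'i; apply: IHr => [|j].
        by rewrite mulrCA => j; rewrite coefy_xvar; apply: IX.
      rewrite coefy_xvar leq_eqVlt => /orP[/eqP<-|rj]; last by apply: IX; apply: rG.
      by apply: IHi => //; apply: ltn_trans i_n.
    (* In the coefficient of [y^(r + n - i)], the variable [x_k] meets the coefficient of [G] of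
       index [r + k - i]. The terms with [k > i] lie in [I] by [rG] and those with [k < i] by [xG];
       what remains is [x_i] times the coefficient of index [r]. *)
    have := lG (r + (n - i))%N; rewrite cfl (bigD1 (Ordinal i_n)) //=.
    rewrite ltnNge leq_addl addnK /= => Is.
    rewrite -[X in I X](addrK (\sum_(k < n.+1 | k != Ordinal i_n)
      (if (r + (n - i) < n - k)%N then 0 else
         xvar D n.+1 k * coefy (r + (n - i) - (n - k)) G))).
    apply: IB => //; elim/big_rec: _ => // k f ki If; apply: ID => //.
    case: ifP => // rk; have [ik|ki'] := ltnP k i.
      by rewrite -coefy_xvar; apply: xG.
    apply: IX; apply: rG; move: (ltn_ord k) ki ki'; rewrite -val_eqE /=.
    by move=> *; lia.
  have xG i : (i < n.+1)%N -> exty I (xvar {poly D} n.+1 i * G).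
    move=> i_n; apply: IHr => [|j].
      by rewrite mulrCA => j; rewrite coefy_xvar; apply: IX.
    rewrite coefy_xvar leq_eqVlt => /orP[/eqP<-|rj]; first exact: xr.
    by apply: IX; apply: rG.
  by move=> j; apply: soc => i i_n; rewrite -coefy_xvar; apply: xG.
move=> lG; have [r rG] := coefy_eventually0 G; apply: (step r) => // j /rG ->.
exact: I0.
Qed.
End McCoy.

(** * Eliminating the last variable *)

Section Substitution.
Variables (A : comNzRingType) (n : nat) (g : {mpoly A[n]}).

Definition subl_tuple : n.+1.-tuple {mpoly A[n]} :=
  [tuple (if unlift ord_max i is Some j then 'X_j else g) | i < n.+1].

Definition subl (f : {mpoly A[n.+1]}) : {mpoly A[n]} := f \mPo subl_tuple.

Lemma sublD f h : subl (f + h) = subl f + subl h.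
Proof. exact: raddfD. Qed.

Lemma subl0 : subl 0 = 0.
Proof. exact: raddf0. Qed.

Lemma sublB f h : subl (f - h) = subl f - subl h.
Proof. exact: raddfB. Qed.

Lemma sublM f h : subl (f * h) = subl f * subl h.
Proof. exact: rmorphM. Qed.

Lemma sublC c : subl c%:MP = c%:MP.
Proof. exact: comp_mpolyC. Qed.

Lemma subl_xvar i : (i < n)%N -> subl (xvar A n.+1 i) = xvar A n i.
Proof.
move=> i_n; have iE : widen_ord (leqnSn n) (Ordinal i_n) = fintype.lift ord_max (Ordinal i_n).
  by apply: val_inj; rewrite /= /bump leqNgt i_n.
rewrite -{1}[i]/(val (widen_ord (leqnSn n) (Ordinal i_n))) xvarE /subl comp_mpolyXU.
by rewrite -tnth_nth tnth_mktuple iE liftK -xvarE.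
Qed.

Lemma subl_xlast : subl (xvar A n.+1 n) = g.
Proof.
rewrite -[n in xvar _ _ n]/(val (@ord_max n)) xvarE /subl comp_mpolyXU.
by rewrite -tnth_nth tnth_mktuple unlift_none.
Qed.

Lemma mwiden_xvar i : (i < n)%N -> mwiden (xvar A n i) = xvar A n.+1 i.
Proof.
move=> i_n; rewrite -{1}[i]/(val (Ordinal i_n)) xvarE mwidenX mnmwiden1.
by rewrite -xvarE.
Qed.

Lemma mpoly_ind_alg k (P : {mpoly A[k]} -> Prop) :
  (forall c, P c%:MP) -> (forall i : 'I_k, P 'X_i) ->
  (forall f h, P f -> P h -> P (f + h)) ->
  (forall f h, P f -> P h -> P (f * h)) -> forall f, P f.
Proof.
move=> PC PX PD PM f; rewrite [f]mpolyE.
elim/big_rec: _ => [|m h _ Ph]; first exact: (PC 0).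
apply: (PD) => //; rewrite -mul_mpolyC; apply: (PM) => //.
rewrite mpolyXE_id; elim/big_rec: _ => [|i u _ Pu]; first exact: (PC 1).
apply: (PM) => //; elim: (m i) => [|a IH]; first exact: (PC 1).
by rewrite exprS; apply: PM.
Qed.

Lemma subl_widen f : subl (mwiden f) = f.
Proof.
elim/mpoly_ind_alg: f => [c|i|f h fE hE|f h fE hE].
- by rewrite mwidenC sublC.
- by rewrite -xvarE mwiden_xvar // subl_xvar.
- by rewrite mwidenD sublD fE hE.
- by rewrite mwidenM sublM fE hE.
Qed.

(** The factor theorem for the kernel of the substitution, without division: the property holds for
    constants and variables, and passes to sums and products. *)
Lemma subl_ker f : exists h, f - mwiden (subl f) = (xvar A n.+1 n - mwiden g) * h.
Proof.
elim/mpoly_ind_alg: f => [c|i|f1 f2 [h1 E1] [h2 E2]|f1 f2 [h1 E1] [h2 E2]].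
- by exists 0; rewrite sublC mwidenC subrr mulr0.
- rewrite -xvarE; have := ltn_ord i; rewrite ltnS leq_eqVlt => /orP[/eqP->|i_n].
    by exists 1; rewrite subl_xlast mulr1.
  by exists 0; rewrite subl_xvar // mwiden_xvar // subrr mulr0.
- by exists (h1 + h2); rewrite sublD mwidenD mulrDr -E1 -E2 opprD addrACA.
- exists (h1 * f2 + mwiden (subl f1) * h2).
  rewrite sublM mwidenM mulrDr mulrA -E1 mulrCA -E2 mulrBl mulrBr addrA.
  by rewrite subrK.
Qed.

Lemma degs_subl Q f : degs (eq 1%N) g -> degs Q f -> degs Q (subl f).
Proof.
move=> g1 Qf; rewrite /subl comp_mpolyEX big_seq; apply: degs_sum => m fm.
apply: degsZ; rewrite comp_mpolyX.
suff mE : degs (eq (mdeg m)) (\prod_(i < n.+1) tnth subl_tuple i ^+ m i).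
  by apply: degs_sub mE => _ <-; apply: Qf; rewrite -mcoeff_msupp.
rewrite mdegE; elim/big_rec2: _ => [|i u a _ ua]; first exact: degsC.
apply: (degsM (Q := eq (m i))) ua; last first.
  elim: (m i) => [|b IH]; first by rewrite expr0; exact: degsC.
  rewrite exprS; apply: (degsM (Q := eq 1%N)) IH; last first.
    rewrite tnth_mktuple; case: unlift => // j; rewrite -xvarE.
    exact: degs_xvar.
  by move=> ? ? <- <-; rewrite add1n.
by move=> ? ? <- <-.
Qed.

End Substitution.

Notation reg R := (R^o : lmodType R).
Notation KinR := (Kin (M := reg _)).
Notation KmapR := (Kmap (M := reg _) (N := reg _)).

(* [H_i(x; S/I) = 0] for all [i > p], with cycles lifted to [S]. *)
Definition Kvanish (D : comNzRingType) n p (I : {mpoly D[n]} -> Prop) :=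
  forall i (z : Kz n (reg {mpoly D[n]})), (p <= i)%N ->
    KinR i.+1 (fun=> True) z -> KinR i I (dK (xvar D n) z) ->
    exists2 w : Kz n (reg {mpoly D[n]}),
      KinR i.+2 (fun=> True) w & KinR i.+1 I (z - dK (xvar D n) w).

Section Socle.
Variables (D : comNzRingType) (n p : nat) (I : {mpoly D[n.+1]} -> Prop).
Hypothesis subI : var_stable I.

(** Koszul homology in the top exterior degree [n + 1] is the socle of [S/I]: a top form with
    coefficient [f] is a cycle modulo [I] when every variable sends [f] into [I], and no chain of
    higher degree can bound it. *)
Lemma Kvanish_socle : (p <= n)%N -> Kvanish p I ->
  forall f, (forall i, (i < n.+1)%N -> I (xvar D n.+1 i * f)) -> I f.
Proof.
move=> pn KV f If; have [cI _] := subI.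
have [||w] := KV n (Ktop n.+1 (f : reg {mpoly D[n.+1]})) pn.
- exact/Kin_top.
- exact: (@Kin_dK_top _ _ n.+1 (reg {mpoly D[n.+1]})).
move=> /Kin_large -> //; rewrite dK0 subr0 => /Kin_top; apply.
by case: cI.
Qed.

End Socle.

Section Extension.
Variables (D : comNzRingType) (n p : nat) (I : {mpoly D[n]} -> Prop).
Hypothesis subI : var_stable I.
Local Notation S := (reg {mpoly D[n]}).
Local Notation Sy := (reg {mpoly {poly D}[n]}).

Lemma Kmap_coefy_eventually0 m (z : Kz m Sy) : exists r, forall j, (r <= j)%N ->
  KmapR (@coefy D n j) z = 0.
Proof.
elim: m z => [|m IH] z; first exact: coefy_eventually0.
case: z => a b; have [r ra] := IH a; have [s sb] := IH b.
exists (maxn r s) => j; rewrite geq_max => /andP[rj sj] /=.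
by rewrite ra // sb.
Qed.

Lemma Kmap_dK_coefy m j (z : Kz m Sy) : KmapR (@coefy D n j) (dK (xvar {poly D} n) z)
  = dK (xvar D n) (KmapR (@coefy D n j) z).
Proof.
apply: Kmap_dK => [|i u _]; first exact: coefyD.
exact: coefy_xvar.
Qed.

Lemma Kmap_coefy_ypow m j k (u : Kz m S) :
  KmapR (@coefy D n j) (ypow D n k *: (KmapR (@emby D n) u : Kz m Sy)) =
  if j == k then u else 0.
Proof.
elim: m u => [|m IH] u /=.
  rewrite -[X in coefy _ X]/(_ * _) coefy_ypow coefy_emby subn_eq0.
  by case: ltngtP.
by rewrite !IH; case: eqP => //; case: u.
Qed.

(** [D[y]] is free over [D], so each power of [y] is filled separately; only finitely many
    coefficients of [z] are nonzero, so the fillings assemble into the polynomial chain [W]. *)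
Lemma Kvanish_exty : Kvanish p I -> Kvanish p (exty I).
Proof.
move=> KV i z pi zi dz; have [[I0 IB] IX] := subI.
have wP j : exists w : Kz n S, KinR i.+2 (fun=> True) w /\
    KinR i.+1 I (KmapR (@coefy D n j) z - dK (xvar D n) w).
  have [|||w w1 w2] := KV i (KmapR (@coefy D n j) z) => //.
  - by apply: Kin_Kmap zi => //; exact: coefy0.
  - by rewrite -Kmap_dK_coefy; apply: Kin_Kmap dz => [|u]; [exact: coefy0 | apply].
  - by exists w.
have [r rz] := Kmap_coefy_eventually0 z.
have [w /all_and2[w1 w2]] := fin_all_exists (fun j : 'I_r => wP j).
pose W : Kz n Sy := \sum_(j < r) ypow D n j *: KmapR (@emby D n) (w j).
have cD j m := Kmap_additive (M := Sy) (N := S) (m := m) (@coefyD D n j).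
have c0 j m := Kmap0 (M := Sy) (N := S) m (@coefy0 D n j).
have WE j : KmapR (@coefy D n j) W =
    if insub j is Some k then w k else 0.
  rewrite /W (big_morph _ (cD j n) (c0 j n)).
  under eq_bigr do rewrite Kmap_coefy_ypow.
  case: insubP => [k jr kj|jr].
    rewrite (bigD1 k) //= -kj eqxx big1 ?addr0 // => l lk.
    by rewrite -val_eqE eq_sym in lk; rewrite (negPf lk).
  by rewrite big1 // => l _; case: eqP jr => // ->; rewrite ltn_ord.
have cT (M : zmodType) : zclosed (fun _ : M => True) by [].
exists W.
  apply: Kin_sum => // k; apply: (KinZ (P := fun=> True)) => //.
  by apply: (Kin_Kmap (P := fun=> True)) (w1 k) => //; exact: emby0.
apply: (Kin_forall (M := Sy) (N := S) 0%N (P := fun=> True)).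
  apply: KinB => //; apply: (Kin_dK (P := fun=> True)) => //.
  apply: Kin_sum => // k; apply: (KinZ (P := fun=> True)) => //.
  by apply: (Kin_Kmap (P := fun=> True)) (w1 k) => //; exact: emby0.
move=> j; rewrite cD -scaleN1r (KmapZ (c' := -1)) => [|u]; last first.
  by rewrite -[LHS]/(coefy j (-1 * u)) mulN1r -sub0r coefyB coefy0 sub0r scaleN1r.
rewrite scaleN1r Kmap_dK_coefy WE; case: insubP => [k jr kj|jr].
  by rewrite -kj; apply: w2.
have rj : (r <= j)%N by rewrite leqNgt.
rewrite (rz _ rj) dK0 subr0; exact: Kin0.
Qed.
End Extension.

Section Elimination.
Variables (A : comNzRingType) (n : nat).
Local Notation S := (reg {mpoly A[n.+1]}).
Local Notation S' := (reg {mpoly A[n]}).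
Variables (g : {mpoly A[n]}) (gam : nat -> {mpoly A[n.+1]}) (l : {mpoly A[n.+1]}).
Hypothesis lE : l = xvar A n.+1 n + \sum_(i < n) gam i * xvar A n.+1 i.
Hypothesis lg : l = xvar A n.+1 n - mwiden g.
Variable J : {mpoly A[n.+1]} -> Prop.
Hypothesis subJ : var_stable J.
Hypothesis gamJ : forall i f, J f -> J (gam i * f).
Hypothesis lJ : forall f, J (l * f) -> J f.

Definition elim_image (f : {mpoly A[n]}) := exists2 F, J F & subl g F = f.

Lemma elim_image_var_stable : var_stable elim_image.
Proof.
have [[J0 JB] JX] := subJ; do ?split.
- by exists 0; rewrite ?subl0.
- move=> _ _ [F JF <-] [G JG <-]; exists (F - G); first exact: JB.
  by rewrite sublB.
- move=> j _ [F JF <-]; have [jn|nj] := ltnP j n; last first.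
    by exists 0; rewrite // subl0 xvar_out // mul0r.
  by exists (xvar A n.+1 j * F); [apply: JX | rewrite sublM subl_xvar].
Qed.

Lemma subl_l : subl g l = 0.
Proof. by rewrite lg sublB subl_xlast subl_widen subrr. Qed.

Lemma Kmap_subl_dK m (z : Kz m S) : (m <= n)%N ->
  KmapR (subl g) (dK (xvar A n.+1) z) = dK (xvar A n) (KmapR (subl g) z : Kz m S').
Proof.
move=> mn; apply: Kmap_dK => [|j u jm]; first exact: sublD.
by rewrite -[LHS]/(subl g (_ * _)) sublM subl_xvar // (leq_trans jm).
Qed.

Lemma Kmap_subl_l m (z : Kz m S) : KmapR (subl g) (l *: z) = 0 :> Kz m S'.
Proof.
rewrite (KmapZ (c' := 0)) ?scale0r // => u.
by rewrite -[LHS]/(subl g (_ * _)) sublM subl_l mul0r scale0r.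
Qed.

(* The change of basis [e_n |-> e_n - \sum_(i < n) gam i e_i] of the exterior
   algebra turns the last variable into [l]. *)
Lemma dK_shear (a b : Kz n S) :
  dK (xvar A n.+1) (a - wedge gam b) + l *: b =
  dK (xvar A n.+1) a + xvar A n.+1 n *: b + wedge gam (dK (xvar A n.+1) b).
Proof.
rewrite dKB lE scalerDl -(dK_wedge (xvar A n.+1) gam b) addrACA.
by rewrite [X in _ + X]addrA addNr add0r.
Qed.

(** As [l] is regular modulo [J], reducing modulo [l] and dropping one variable does not change
    Koszul homology. Concretely, a lift [z] of a cycle satisfies [dK z = h + l *: b] with [h] in
    [J]. Then [z] and [b] together give a cycle modulo [J] in [n + 1] variables; substituting in a
    filling of it fills the given cycle. *)
Lemma Kvanish_elim_image p : Kvanish p J -> Kvanish p elim_image.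
Proof.
move=> KV i z' pi zi dz; have [cJ JX] := subJ; have [J0 JB] := cJ.
pose z : Kz n S := KmapR (@mwiden n A) z'.
have zT : KinR i.+1 (fun=> True) z.
  by apply: Kin_Kmap zi => //; exact: mwiden0.
have zE : KmapR (subl g) z = z'.
  by apply: Kmap_cancel => u; exact: subl_widen.
have [h Jh hE] : exists2 h : Kz n S, KinR i J h & KmapR (subl g) h = dK (xvar A n) z'.
  apply: Kin_lift dz; first exact: subl0.
  by move=> _ [F JF <-]; exists F.
have dzT : KinR i (fun=> True) (dK (xvar A n.+1) z).
  by apply: (Kin_dK (P := fun=> True)) zT.
have hT : KinR i (fun=> True) h by apply: Kin_sub Jh.
have subD m := Kmap_additive (M := S) (N := S') (m := m) (@sublD A n g).
have subB m (u v : Kz m S) : KmapR (subl g) (u - v) =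
    (KmapR (subl g) u - KmapR (subl g) v : Kz m S').
  rewrite subD -scaleN1r (KmapZ (c' := -1)) ?scaleN1r // => w.
  by rewrite -[LHS]/(subl g (_ * _)) mulN1r -sub0r sublB subl0 sub0r scaleN1r.
have [b bT bE] : exists2 b : Kz n S, KinR i (fun=> True) b & l *: b = dK (xvar A n.+1) z - h.
  apply: (Kin_divide (P := fun u : S => True /\ subl g u = 0)) => [v [_ gv]|].
    by have [u uE] := subl_ker g v; exists u => //; rewrite lg -[LHS]/(_ * u) -uE gv mwiden0 subr0.
  apply: (Kin_ker (M := S) (N := S') (f := subl g) (P := fun=> True)); first by apply: KinB.
  by rewrite subB Kmap_subl_dK // zE hE subrr.
have wT k (u : Kz n S) : KinR k (fun=> True) u -> KinR k.+1 (fun=> True) (wedge gam u).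
  exact: (Kin_wedge (P := fun=> True)).
have wJ k (u : Kz n S) : KinR k J u -> KinR k.+1 J (wedge gam u).
  by apply: (Kin_wedge (M := S) (P := J)) => // j u' _; apply: gamJ.
have dJ k (u : Kz n S) : KinR k.+1 J u -> KinR k J (dK (xvar A n.+1) u).
  by apply: (Kin_dK (M := S) (P := J)) => // j u' _; apply: JX.
(* Applying the differential to [l *: b = dK z - h] gives [l *: dK b = - dK h], and [l] cancels
   modulo [J]. *)
have dbJ k : i = k.+1 -> KinR k J (dK (xvar A n.+1) b).
  move=> ik; rewrite ik in bT Jh; apply: (Kin_scale_inv (M := S) (Q := J) (c := l)) => //.
    by apply: (Kin_dK (P := fun=> True)) bT.
  by rewrite -dKZ bE dKB dK_dK sub0r; apply: KinN => //; apply: dJ.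
(* The chain whose components in the changed basis are [z] and [- b]. *)
pose y : Kz n.+1 S := (z - wedge gam b, - b).
have yT : KinR i.+1 (fun=> True) y.
  by split; [apply: KinB => //; apply: wT | apply: KinN].
have yJ : KinR i J (dK (xvar A n.+1) y).
  split=> /=.
    suff -> : dK (xvar A n.+1) (z - wedge gam b) + xvar A n.+1 n *: - b =
              h + wedge gam (dK (xvar A n.+1) b).
      apply: KinD => //; case: (i) dbJ bT => [|k] dbJ bT; last by apply: wJ; apply: dbJ.
      by rewrite (Kin_dK0 _ bT) wedge0; apply: Kin0.
    have /(canRL (addrK _)) -> := dK_shear z b.
    rewrite bE scalerN; apply/eqP; rewrite !subr_eq; apply/eqP.
    by rewrite [RHS](AC (3*2) (4*3*2*(1*5))) /= subrr addr0.
  case: (i) dbJ bT => [|k] dbJ bT.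
    by rewrite dKN (Kin_dK0 _ bT) !oppr0.
  by rewrite dKN opprK; apply: dbJ.
have [[a' b'] [a'T b'T] [/= Ja Jb]] := KV i y pi yT yJ.
(* This is the first component, in the changed basis, of [y - dK (a', b')]. *)
have vJ : KinR i.+1 J (z - (dK (xvar A n.+1) (a' - wedge gam b') + l *: b')).
  suff -> : z - (dK (xvar A n.+1) (a' - wedge gam b') + l *: b') =
      (z - wedge gam b - (dK (xvar A n.+1) a' + xvar A n.+1 n *: b')) -
      wedge gam (- b - - dK (xvar A n.+1) b').
    by apply: KinB => //; apply: wJ.
  rewrite dK_shear opprK wedgeD wedgeN !opprD !opprK.
  by rewrite [RHS](AC (2*2*2) ((1*(3*4*6))*(2*5))) /= addNr addr0.
exists (KmapR (subl g) (a' - wedge gam b')).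
  apply: (Kin_Kmap (P := fun=> True)) => //; first exact: subl0.
  by apply: KinB => //; apply: wT.
have -> : z' - dK (xvar A n) (KmapR (subl g) (a' - wedge gam b')) =
    KmapR (subl g) (z - (dK (xvar A n.+1) (a' - wedge gam b') + l *: b')).
  by rewrite [RHS]subB zE [X in _ = _ - X]subD Kmap_subl_l addr0 Kmap_subl_dK.
apply: Kin_Kmap vJ => [|u Ju]; first exact: subl0.
by exists u.
Qed.

Definition shear (z : Kz n.+1 S) : Kz n S := z.1 - wedge gam z.2.

(** For [i = t - 1], the elements of the space [T] of the overview. *)
Definition lin_cycle (D : comNzRingType) m (I : {mpoly D[m]} -> Prop) d i
    (z : Kz m (reg {mpoly D[m]})) :=
  KinR i (fun f => I f /\ degs (eq d) f) z /\ dK (xvar D m) z = 0.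

Lemma Kin_shear d i z : (forall j, degs (eq 0%N) (gam j)) ->
  lin_cycle J d i z -> KinR i (fun f => J f /\ degs (eq d) f) (shear z).
Proof.
move=> gam0 [zJ _]; have [[J0 JB] JX] := subJ.
case: z zJ => a b [/= aJ bJ].
have cP : zclosed (fun f => J f /\ degs (eq d) f).
  have [d0 dB] := degs_zclosed A n.+1 (eq d).
  by split=> // u v [? ?] [? ?]; split; [apply: JB | apply: dB].
apply: (KinB (M := S) cP) => //.
have wP k (u : Kz n S) : KinR k (fun f => J f /\ degs (eq d) f) u ->
    KinR k.+1 (fun f => J f /\ degs (eq d) f) (wedge gam u).
  apply: (Kin_wedge (M := S) (P := fun f => J f /\ degs (eq d) f)) => // j u' _ [Ju ud].
  by split; [apply: gamJ | apply: degsM (gam0 j) ud => ? ? <- <-].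
case: i {aJ} bJ => [|i] bJ; last exact: wP.
by rewrite /= bJ wedge0; apply: (@Kin0 _ n 0 S); case: cP.
Qed.

Lemma dK_shear_cycle (z : Kz n.+1 S) : dK (xvar A n.+1) z = 0 ->
  dK (xvar A n.+1) (shear z) = - (l *: z.2).
Proof.
case: z => a b [/= da /eqP]; rewrite oppr_eq0 => /eqP db.
have := dK_shear a b; rewrite db wedge0 addr0 da => /(canRL (addrK _)) ->.
by rewrite sub0r.
Qed.

Lemma lin_cycle_shear d i z : (forall j, degs (eq 0%N) (gam j)) -> degs (eq 1%N) g ->
  lin_cycle J d i z -> lin_cycle elim_image d i (KmapR (subl g) (shear z)).
Proof.
move=> gam0 g1 cz; split.
  apply: (Kin_Kmap (M := S) (N := S')) (Kin_shear gam0 cz); first exact: subl0.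
  by move=> u [Ju ud]; split; [exists u | apply: degs_subl].
rewrite -Kmap_subl_dK // dK_shear_cycle; last by case: cz.
by rewrite -scalerN; exact: Kmap_subl_l.
Qed.

(* An element of [J] of degree [d] killed by [subl g] is [l * h] with [h] in
   [J], so it has degree [> d]; hence a cycle is determined by its shear. *)
Lemma shear_inj d i z : (forall j, degs (eq 0%N) (gam j)) ->
  (forall f, J f -> degs (leq d) f) -> degs (eq 1%N) l ->
  (forall f, l * f = 0 -> f = 0) ->
  lin_cycle J d i z -> KmapR (subl g) (shear z) = 0 :> Kz n S' -> z = 0.
Proof.
move=> gam0 Jd l1 linj cz sz.
have sz0 : shear z = 0.
  apply: (Kin_inj (M := S) (N := S')) (Kin_shear gam0 cz) sz => u [Ju ud] u0.
  have [h] := subl_ker g u; rewrite u0 mwiden0 subr0 -lg => uE.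
  have hd : degs (leq d) h by apply: Jd; apply: lJ; rewrite -uE.
  apply/mpolyP => m; rewrite mcoeff0; apply/eqP; apply/negPn/negP => um.
  have := ud _ um; have : degs (leq d.+1) u.
    by rewrite uE; apply: degsM l1 hd => ? ? <- ?.
  by move=> /(_ _ um) + dm; rewrite dm ltnn.
have [_ dz] := cz; have := dK_shear_cycle dz; rewrite sz0 dK0 => /eqP.
rewrite eq_sym oppr_eq0 => /eqP /KzZ_inj z2.
case: z {cz sz dz} sz0 z2 => a b; rewrite /shear /= => ab z2.
have b0 : b = 0 by apply: z2.
by move: ab; rewrite b0 wedge0 subr0 => ->.
Qed.

End Elimination.

(** * Counting cycles *)

Lemma fraction_numden (D : idomainType) (x : {fraction D}) :
  exists a b : D, b != 0 /\ x * FracField.tofrac b = FracField.tofrac a.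
Proof.
elim/quotW: x => y; exists (frac y).1, (frac y).2; split; first exact: denom_ratioP.
apply/eqP; rewrite -[_ * _]/(FracField.mul _ _) !piE FracField.equivfE /FracField.mulf.
by rewrite !numden_Ratio ?mulf_neq0 ?denom_ratioP ?oner_neq0 // !mulr1 mulrC.
Qed.

(** Both sides are the multinomial coefficient [(e + n)! / (e! i! (n - i)!)], or 0 if [n < i]. *)
Lemma bin_exchange e n i : ('C(e + i, i) * 'C(e + n, e + i) = 'C(n, i) * 'C(n + e, n))%N.
Proof.
have [ni|i_n] := ltnP n i.
  by rewrite (bin_small ni) (@bin_small (e + n) (e + i)) ?ltn_add2l // muln0.
have pos : (0 < i`! * e`! * (n - i)`!)%N by rewrite !muln_gt0 !fact_gt0.
have H1 := bin_fact (leq_addl e i); rewrite addnK in H1.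
have H2 := bin_fact (_ : e + i <= e + n)%N; rewrite leq_add2l subnDl in H2.
have H3 := bin_fact i_n.
have H4 := bin_fact (leq_addr e n); rewrite addKn in H4.
have n0 : (0 < n`! * (e + i)`!)%N by rewrite muln_gt0 !fact_gt0.
apply/eqP; rewrite -(eqn_pmul2r pos) -(eqn_pmul2r n0); apply/eqP.
transitivity ((e + n)`! * (e + i)`! * n`!)%N.
  by rewrite -(H2 i_n) -{2}H1; ring.
by rewrite (addnC e n) -{1}H4 -{1}H3; ring.
Qed.

(** A relation over the fraction field, cleared of denominators. Domains are the right generality
    because elimination replaces [D] by [D[y]]. *)
Lemma domain_dependence (D : idomainType) (T : finType) m (L : 'I_m -> T -> D) :
  (#|T| < m)%N ->
  exists c : 'I_m -> D, (exists l, c l != 0) /\ forall t, \sum_l c l * L l t = 0.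
Proof.
move=> Tm; pose B := \matrix_(l < m, j < #|T|) FracField.tofrac (L l (enum_val j)).
have : kermx B != 0.
  rewrite -mxrank_eq0 mxrank_ker subn_eq0 -ltnNge.
  by apply: leq_ltn_trans Tm; apply: rank_leq_col.
case/rowV0Pn => v /sub_kermxP vB v0.
have [N [d [d0 dN]]] : exists (N : 'I_m -> D) (d : D),
    d != 0 /\ forall l, v 0 l * FracField.tofrac d = FracField.tofrac (N l).
  have num l : exists ab : D * D, ab.2 != 0 /\
      v 0 l * FracField.tofrac ab.2 = FracField.tofrac ab.1.
    by have [a [b ab]] := fraction_numden (v 0 l); exists (a, b).
  have [ab /all_and2[b0 abE]] := fin_all_exists num.
  exists (fun l => (ab l).1 * \prod_(k | k != l) (ab k).2), (\prod_k (ab k).2).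
  split; first by apply/prodf_neq0.
  by move=> l; rewrite (bigD1 l) //= !tofracM mulrA abE.
exists N; split.
  have [l vl] : exists l, v 0 l != 0.
    apply/existsP; apply: contraNT v0 => /existsPn v0; apply/eqP/rowP => l.
    by rewrite mxE; apply/eqP; have := v0 l; rewrite negbK.
  by exists l; rewrite -tofrac_eq0 -dN mulf_neq0 // tofrac_eq0.
move=> t; apply/eqP; rewrite -tofrac_eq0 (big_morph _ (@tofracD D) (@tofrac0 D)).
have /matrixP/(_ 0 (enum_rank t)) := vB; rewrite !mxE => vt.
have /eqP := congr1 (fun x => x * FracField.tofrac d) vt; rewrite mul0r mulr_suml.
congr (_ == _); apply: eq_bigr => l _.
by rewrite mxE enum_rankK tofracM -dN mulrAC.
Qed.

Section Functionals.
Variable D : comNzRingType.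

Definition lin_functional n m (L : Kz m (reg {mpoly D[n]}) -> D) :=
  forall c u v, L (c%:MP *: u + v) = c * L u + L v.

Lemma component_functionals n m i (E : finType) (e : E -> {mpoly D[n]} -> D) :
  (forall x c u v, e x (c%:MP * u + v) = c * e x u + e x v) ->
  exists (T : finType) (L : T -> Kz m (reg {mpoly D[n]}) -> D),
    [/\ #|T| = ('C(m, i) * #|E|)%N, forall t, lin_functional (L t) &
      forall P z, KinR i P z -> (forall t, L t z = 0) ->
        KinR i (fun u => P u /\ forall x, e x u = 0) z].
Proof.
move=> e_lin; elim: m i => [|m IH] [|i].
- by exists E, e; split; [rewrite bin0 mul1n | exact: e_lin | move=> P z /= Pz Lz].
- exists void, (fun _ _ => 0); split; [by rewrite card_void | by case |].
  by move=> P z /= ->.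
- have [T [L [cT linL LP]]] := IH 0%N.
  exists T, (fun t z => L t z.1); split; first by rewrite cT !bin0.
    by move=> t c u v; rewrite /= linL.
  by move=> P z /= [z1 z2] Lz; split=> //; apply: LP.
- have [T [L [cT linL LP]]] := IH i.+1; have [T' [L' [cT' linL' LP']]] := IH i.
  exists (T + T')%type, (fun t z => match t with inl x => L x z.1 | inr x => L' x z.2 end).
  split; first by rewrite card_sum cT cT' binS mulnDl.
    by case=> t c u v; [apply: linL | apply: linL'].
  move=> P z /= [z1 z2] Lz; split.
    by apply: LP => // t; apply: (Lz (inl t)).
  by apply: LP' => // t; apply: (Lz (inr t)).
Qed.

(** Dividing by the last variable turns the monomials of degree [e + 1] that it divides into all
    monomials of degree [e] in [n + 1] variables, whence the binomial. *)
Lemma monomial_functionals n e : exists (E : finType) (f : E -> {mpoly D[n.+1]} -> D),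
  [/\ #|E| = 'C(n + e, n), forall x c u v, f x (c%:MP * u + v) = c * f x u + f x v &
    forall u, (forall x, f x u = 0) ->
      forall m, mdeg m = e -> u@_(m + U_(ord_max)) = 0].
Proof.
pose A := [set t : n.+1.-tuple 'I_e.+1 | (\sum_(i <- t) i)%N == e].
pose mon (t : n.+1.-tuple 'I_e.+1) : 'X_{1..n.+1} :=
  [multinom nat_of_ord (tnth t j) | j < n.+1].
exists {t | t \in A}, (fun t u => u@_(mon (val t) + U_(ord_max))); split.
- by rewrite card_sig card_ord_partitions -bin_sub ?leq_addr // addKn.
- by move=> x c u v; rewrite mcoeffD mcoeffCM.
move=> u u0 m me.
pose t : n.+1.-tuple 'I_e.+1 := [tuple inord (m j) | j < n.+1].
have tE j : nat_of_ord (tnth t j) = m j.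
  rewrite tnth_mktuple inordK // ltnS -me mdegE (bigD1 j) //=; exact: leq_addr.
have tA : t \in A.
  rewrite inE big_tuple; apply/eqP; rewrite -[RHS]me mdegE.
  by apply: eq_bigr => j _; rewrite tE.
have <- : mon t = m by apply/mnmP => j; rewrite mnmE tE.
exact: (u0 (Sub t tA)).
Qed.

(* A cycle [(a, b)] is determined by [a], as [dK a + x_n b = 0]. In turn [a] is
   determined by its reduction modulo [x_n], which is a cycle in one variable
   less, and by its coefficients on the monomials divisible by [x_n]. *)
Lemma cycle_functionals n i d : (0 < d)%N ->
  exists (T : finType) (L : T -> Kz n (reg {mpoly D[n]}) -> D),
    [/\ #|T| = ('C(d + i - 1, i) * 'C(d + n - 1, d + i))%N,
        forall t, lin_functional (L t) &
      forall z, KinR i (degs (eq d)) z -> dK (xvar D n) z = 0 ->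
        (forall t, L t z = 0) -> z = 0].
Proof.
case: d => // e _; elim: n i => [|n IH] i.
  exists void, (fun _ _ => 0); split.
  - by rewrite card_void [X in (_ * X)%N]bin_small ?muln0 //; lia.
  - by case.
  case: i => //= z dz _ _; apply/mpolyP => m; rewrite mcoeff0; apply/eqP/negPn/negP => /dz.
  by rewrite mdegE big_ord0.
have [T [L [cT linL LP]]] := IH i.
have [E [f [cE f_lin fP]]] := monomial_functionals n e.
have [T' [L' [cT' linL' LP']]] := component_functionals n i f_lin.
pose S := reg {mpoly D[n.+1]}; pose S' := reg {mpoly D[n]}.
exists (T + T')%type, (fun t z => match t with
  inl x => L x (KmapR (subl (0 : {mpoly D[n]})) z.1 : Kz n S') | inr x => L' x z.1 end).
split.
(* Pascal's rule on the second binomial. One summand is the count for [n] variables; by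
   [bin_exchange] the other is the number of components times the number of monomials of degree
   [e + 1] divisible by the last variable. *)
- rewrite card_sum cT cT' cE !addSn !subn1 /= addnS binS mulnDr; congr addn.
  by rewrite bin_exchange.
- case=> t c u v; last exact: linL'.
  rewrite -linL; congr (L t _).
  have sD m := Kmap_additive (M := S) (N := S') (m := m) (@sublD D n 0).
  rewrite sD (KmapZ (c' := c%:MP)) // => w.
  by rewrite -[LHS]/(subl 0 (_ * _)) sublM sublC.
case=> a b [/= ad bd] [da _] Lz.
have a0 : a = 0.
  apply: (Kin_inj (M := S) (N := S') (f := subl (0 : {mpoly D[n]}))) (LP' _ _ ad _) _.
  - move=> u [ud fu] u0; have [h] := subl_ker 0 u; rewrite u0 !mwiden0 !subr0 => uE.
    have {}fP := fP u fu.
    apply/mpolyP => m; rewrite mcoeff0; apply/eqP/negPn/negP => um.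
    have mn : m ord_max != 0%N.
      apply: contraNneq um => mn; rewrite uE -[n in xvar _ _ n]/(val (@ord_max n)).
      by rewrite xvarE mcoeffXM mn.
    have mE : (m - U_(ord_max) + U_(ord_max))%MM = m by rewrite submK // lep1mP.
    have := ud _ um; rewrite -mE mdegD mdeg1 addn1 => -[] me.
    by move: um; rewrite -mE fP ?eqxx.
  - by move=> t; have := Lz (inr t).
  apply: LP => [||t]; last by have := Lz (inl t).
  - apply: (Kin_Kmap (M := S) (N := S')) ad; first exact: subl0.
    by move=> u ud; apply: degs_subl => //; case: (degs_zclosed D n (eq 1%N)).
  have X0 : xvar D n.+1 n - mwiden (0 : {mpoly D[n]}) = xvar D n.+1 n.
    by rewrite mwiden0 subr0.
  rewrite -Kmap_subl_dK // (canRL (addrK _) da) sub0r -scalerN -X0.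
  exact: Kmap_subl_l.
move: da; rewrite a0 dK0 add0r => /KzZ_inj ->; first by [].
by move=> u; apply: xvar_inj.
Qed.
End Functionals.

(** * Dependence of cycles, by induction on the number of variables *)

Definition scaled (D : comNzRingType) n (I : {mpoly D[n]} -> Prop) :=
  forall c f, I f -> I (c%:MP * f).

Lemma coefyCM (D : comNzRingType) n j (c : {poly D}) (F : {mpoly {poly D}[n]}) :
  coefy j (c%:MP * F) = \sum_(a < j.+1) (c`_a)%:MP * coefy (j - a) F.
Proof.
apply/mpolyP => m; rewrite mcoeff_coefy mcoeffCM coefM raddf_sum /=.
by apply: eq_bigr => a _; rewrite mcoeffCM mcoeff_coefy.
Qed.

Lemma Kmap_coefyC (D : comNzRingType) n m j (c : {poly D}) (u : Kz m (reg {mpoly D[n]})) :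
  KmapR (@coefy D n j) (c%:MP *: (KmapR (@emby D n) u : Kz m (reg {mpoly {poly D}[n]}))) =
  (c`_j)%:MP *: u.
Proof.
elim: m u => [|m IH] u /=; last by rewrite !IH.
apply/mpolyP => a; rewrite -[X in coefy _ X]/(_ * _) -[RHS]/((_ * _)@_a).
by rewrite mcoeff_coefy !mcoeffCM mcoeff_emby coefMC.
Qed.

Lemma exty_scaled (D : comNzRingType) n (I : {mpoly D[n]} -> Prop) :
  var_stable I -> scaled I -> scaled (exty I).
Proof.
move=> [[I0 IB] _] Ic c F IF j; rewrite coefyCM.
have ID f g : I f -> I g -> I (f + g).
  by move=> If Ig; rewrite -[g]opprK; apply: (IB) => //; rewrite -sub0r; apply: IB.
by elim/big_rec: _ => // a f _; apply: ID; apply: Ic; apply: IF.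
Qed.

Lemma elim_image_scaled (A : comNzRingType) n g (J : {mpoly A[n.+1]} -> Prop) :
  scaled J -> scaled (elim_image g J).
Proof.
move=> Jc c _ [F JF <-]; exists (c%:MP * F); first exact: Jc.
by rewrite sublM sublC.
Qed.

Lemma exty_degs (D : comNzRingType) n Q (I : {mpoly D[n]} -> Prop) :
  (forall f, I f -> degs Q f) -> forall F, exty I F -> degs Q F.
Proof.
move=> IQ F IF m Fm.
have [j Fj] : exists j, (F@_m)`_j != 0.
  by exists (size F@_m).-1; rewrite -[_`_ _]/(lead_coef _) lead_coef_eq0.
by apply: (IQ _ (IF j)); rewrite mcoeff_coefy.
Qed.

Section CycleCombinations.
Variables (D : comNzRingType) (n d i : nat) (I : {mpoly D[n]} -> Prop).
Hypotheses (subI : var_stable I) (Ic : scaled I).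

Lemma lin_cycle_sum m (c : 'I_m -> D) z : (forall l, lin_cycle I d i (z l)) ->
  lin_cycle I d i (\sum_l (c l)%:MP *: z l).
Proof.
have [[I0 IB] IX] := subI; have [d0 dB] := degs_zclosed D n (eq d).
move=> cz; split.
  apply: Kin_sum => [|l].
    by split=> // u v [? ?] [? ?]; split; [apply: IB | apply: dB].
  apply: KinZ (proj1 (cz l)) => u [Iu ud]; split; first exact: Ic.
  by apply: degsM ud; [| exact: degsC] => ? ? <- <-.
by rewrite dK_sum big1 // => l _; rewrite dKZ (proj2 (cz l)) scaler0.
Qed.

End CycleCombinations.

Lemma cycles_dependent n (D : idomainType) (I : {mpoly D[n]} -> Prop) p d i m
    (z : 'I_m -> Kz n (reg {mpoly D[n]})) :
  (0 < d)%N -> var_stable I -> scaled I -> (forall f, I f -> degs (leq d) f) ->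
  Kvanish p I -> (forall l, lin_cycle I d i (z l)) ->
  ('C(d + i - 1, i) * 'C(d + p - 1, d + i) < m)%N ->
  exists c : 'I_m -> D, (exists l, c l != 0) /\ \sum_l (c l)%:MP *: z l = 0.
Proof.
move=> d0.
(* With at most [p] variables, [cycle_functionals] provides fewer functionals than there are cycles,
   so a nontrivial combination is killed by all of them and is 0. *)
have small n' (D' : idomainType) (I' : {mpoly D'[n']} -> Prop)
    (z' : 'I_m -> Kz n' (reg {mpoly D'[n']})) : var_stable I' -> scaled I' ->
  (forall l, lin_cycle I' d i (z' l)) -> (n' <= p)%N ->
  ('C(d + i - 1, i) * 'C(d + p - 1, d + i) < m)%N ->
  exists c : 'I_m -> D', (exists l, c l != 0) /\ \sum_l (c l)%:MP *: z' l = 0.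
  move=> subI' cI' cz np lm; have [T [L [cT linL LP]]] := cycle_functionals D' n' i d0.
  have [|c [cl cE]] := domain_dependence (fun l t => L t (z' l)) (_ : #|T| < m)%N.
    apply: leq_ltn_trans lm; rewrite cT leq_mul2l; apply/orP; right.
    by apply: leq_bin2l; lia.
  exists c; split=> //; have [zP dz] := lin_cycle_sum subI' cI' c cz.
  apply: LP => // [|t]; first by apply: Kin_sub zP => u [].
  rewrite -(cE t); have L0 : L t 0 = 0.
    have := linL t 1 0 0; rewrite scaler0 addr0 mul1r => /(congr1 (fun x => x - L t 0)).
    by rewrite addrK subrr.
  elim/big_rec2: _ => // l y1 y2 _ <-; exact: linL.
elim: n D I z => [|n IH] D I z subI cI Id KV cz lm.
  exact: (small 0%N D I z subI cI cz).
have [np|pn] := leqP n.+1 p; first exact: (small n.+1 D I z subI cI cz).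
pose gam j := ypow D n.+1 (n - j).
pose g : {mpoly {poly D}[n]} := - \sum_(j < n) ypow D n (n - j) * xvar {poly D} n j.
have gE : mwiden g = - \sum_(j < n) gam j * xvar {poly D} n.+1 j.
  rewrite mwidenN; congr (- _); rewrite (big_morph _ (@mwidenD _ _) (@mwiden0 _ _)).
  by apply: eq_bigr => j _; rewrite mwidenM mwidenC mwiden_xvar.
have lE : moment_form D n = xvar {poly D} n.+1 n + \sum_(j < n) gam j * xvar {poly D} n.+1 j.
  rewrite /moment_form big_ord_recr /= addrC; congr (_ + _).
  by rewrite subnn /ypow expr0 mpolyC1 mul1r.
have lg : moment_form D n = xvar {poly D} n.+1 n - mwiden g by rewrite lE gE opprK.
have subE := exty_var_stable subI.
have gamJ j f : exty I f -> exty I (gam j * f) by apply: exty_ypow.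
have gam0 j : degs (eq 0%N) (gam j) by exact: degsC.
have l1 : degs (eq 1%N) (moment_form D n).
  apply: degs_sum => j _; apply: (degsM (Q := eq 0%N) (Q' := eq 1%N)).
  - by move=> ? ? <- <-.
  - exact: degsC.
  - exact: degs_xvar.
have g1 : degs (eq 1%N) g.
  have [g0 gB] := degs_zclosed {poly D} n (eq 1%N).
  rewrite /g -sub0r; apply: gB => //.
  apply: degs_sum => j _; apply: (degsM (Q := eq 0%N) (Q' := eq 1%N)).
  - by move=> ? ? <- <-.
  - exact: degsC.
  - exact: degs_xvar.
have lJ f : exty I (moment_form D n * f) -> exty I f.
  by apply: exty_regular => //; apply: Kvanish_socle KV.
(* Putting [g + 1] for the last variable sends the form to 1, so it is not 0 and cancels in a
   domain. *)
have linj f : moment_form D n * f = 0 -> f = 0.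
  move=> /eqP; rewrite mulf_eq0 => /orP[/eqP l0|/eqP//].
  have /(congr1 (subl (g + 1))) := l0.
  rewrite lg sublB subl_xlast subl_widen subl0 addrAC subrr add0r => /eqP.
  by rewrite oner_eq0.
pose ze l : Kz n.+1 (reg {mpoly {poly D}[n.+1]}) := KmapR (@emby D n.+1) (z l).
have dKe k (u : Kz k (reg {mpoly D[n.+1]})) :
    KmapR (@emby D n.+1) (dK (xvar D n.+1) u) =
    dK (xvar {poly D} n.+1) (KmapR (@emby D n.+1) u : Kz k (reg {mpoly {poly D}[n.+1]})).
  by apply: Kmap_dK => [|j f _]; [exact: embyD | exact: emby_xvar].
have cze l : lin_cycle (exty I) d i (ze l).
  have [zP dz] := cz l; split.
    apply: Kin_Kmap zP => [|f [If fd]]; first exact: emby0.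
    split; first exact: exty_emby.
    by move=> mm; rewrite mcoeff_emby polyC_eq0; apply: fd.
  by rewrite -dKe dz Kmap0 //; exact: emby0.
have [||||||c' [[l0 cl0] cE]] := IH {poly D} (elim_image g (exty I))
    (fun l => KmapR (subl g) (shear gam (ze l))).
- exact: elim_image_var_stable.
- by apply: elim_image_scaled; apply: exty_scaled.
- by move=> _ [F IF <-]; apply: degs_subl => //; apply: exty_degs IF.
- by apply: (Kvanish_elim_image lE lg) => //; apply: Kvanish_exty.
- by move=> l; apply: (lin_cycle_shear lE lg).
- exact: lm.
have c'z : \sum_l (c' l)%:MP *: ze l = 0.
  apply: (shear_inj lE lg) (lin_cycle_sum subE (exty_scaled subI cI) c' cze) _ => //.
    exact: exty_degs.
  pose Phi (z : Kz n.+1 (reg {mpoly {poly D}[n.+1]})) : Kz n (reg {mpoly {poly D}[n]}) :=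
    KmapR (subl g) (shear gam z).
  have PhiD u v : Phi (u + v) = Phi u + Phi v.
    rewrite /Phi -(Kmap_additive (M := reg _) (N := reg _) (@sublD _ _ g)).
    by congr Kmap; rewrite /shear wedgeD opprD addrACA.
  have Phi0 : Phi 0 = 0 by apply: (addrI (Phi 0)); rewrite -PhiD !addr0.
  rewrite -/(Phi _) (big_morph _ PhiD Phi0) -[RHS]cE; apply: eq_bigr => l _.
  rewrite /Phi /shear wedgeZ -scalerBr (KmapZ (c' := (c' l)%:MP)) // => u.
  by rewrite -[LHS]/(subl g (_ * _)) sublM sublC.
(* The [ze l] do not involve [y], so each coefficient in [y] of the relation is a relation over [D];
   the leading coefficient of [c' l0] makes this one nontrivial. *)
pose j := (size (c' l0)).-1; exists (fun l => (c' l)`_j); split.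
  by exists l0; rewrite -[_`_ _]/(lead_coef _) lead_coef_eq0.
have /(congr1 (KmapR (@coefy D n.+1 j))) := c'z.
have c0 : KmapR (@coefy D n.+1 j) (0 : Kz n.+1 (reg {mpoly {poly D}[n.+1]})) = 
    (0 : Kz n.+1 (reg {mpoly D[n.+1]})).
  by rewrite Kmap0 //; exact: coefy0.
rewrite c0 (big_morph _ (Kmap_additive (M := reg _) (N := reg _) (@coefyD D n.+1 j)) c0) => jE.
by rewrite -[RHS]jE; apply: eq_bigr => l _; rewrite Kmap_coefyC.
Qed.

(** * Vanishing from a projective resolution *)

Section FreeCover.
Variables (R : comNzRingType) (P : lmodType R).

Definition free_cover (D : {freeg P / R}) : P := fglift id D.

Lemma free_cover_linear : linear free_cover.
Proof.
have addE u v : free_cover (u + v) = free_cover u + free_cover v.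
  have subE := lift_is_additive (id : P -> P).
  have := subE (u + v) v; rewrite addrK => /eqP; rewrite eq_sym subr_eq => /eqP.
  by [].
have c0 : free_cover 0 = 0 by apply: (addrI (free_cover 0)); rewrite -addE !addr0.
move=> c u v; rewrite addE; congr (_ + _).
have sumE (D : {freeg P / R}) (s : seq P) h :
    free_cover (\sum_(z <- s) << h z *g z >>) = \sum_(z <- s) h z *: z.
  rewrite (big_morph _ addE c0); apply: eq_bigr => z _; exact: liftU.
rewrite -[in RHS](freeg_sumE u) -[c *: u]/(fgscale c u) /fgscale !sumE // scaler_sumr.
by apply: eq_bigr => z _; rewrite scalerA.
Qed.

HB.instance Definition _ :=
  GRing.isLinear.Build R {freeg P / R} P _ free_cover free_cover_linear.

Lemma free_cover_surj x : exists D, free_cover D = x.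
Proof. by exists << 1 *g x >>; rewrite /free_cover liftU scale1r. Qed.

Definition freeg_map (t : R -> R) (D : {freeg P / R}) : {freeg P / R} :=
  \sum_(x <- dom D) << t (coeff x D) *g x >>.

Lemma coeff_freeg_map t x D : t 0 = 0 -> coeff x (freeg_map t D) = t (coeff x D).
Proof.
move=> t0; rewrite /freeg_map raddf_sum /=.
under eq_bigr do rewrite coeffU.
have [xD|xD] := boolP (x \in dom D).
  rewrite (bigD1_seq x) ?uniq_dom //= eqxx mulr1 big1 ?addr0 // => y /negPf ->.
  by rewrite mulr0.
rewrite (coeff_outdom xD) t0 big1_seq // => y /= yD.
by case: eqP yD xD => [-> -> |] //; rewrite mulr0.
Qed.
End FreeCover.

Section ProjectiveAcyclic.
Variables (D : comNzRingType) (n : nat).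
Local Notation S := {mpoly D[n]}.

Lemma free_acyclic (P : lmodType S) i (z : Kz n ({freeg P / S} : lmodType S)) :
  Kin i.+1 (fun=> True) z -> dK (xvar D n) z = 0 ->
  exists2 w : Kz n ({freeg P / S} : lmodType S), Kin i.+2 (fun=> True) w & dK (xvar D n) w = z.
Proof.
move=> zi dz.
have [|||||||w wi wE] := @coord_exact D n ({freeg P / S} : lmodType S) P
  (fun x => coeff x) (@freeg_map S P) _ _ _ _ (fun _ _ _ => True) _ n i 0 z _ _ dz.
- by move=> a u v; rewrite coeffD.
- by move=> a s u; rewrite coeffZ.
- by move=> u v uv; apply/eqP/freeg_eqP => x; apply: uv.
- by move=> t a u t0; apply: coeff_freeg_map.
- by [].
- by [].
- by apply: Kin_sub zi.
by exists w => //; apply: Kin_sub wi.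
Qed.

(** A projective module is a retract of the free module on its underlying set, and the Koszul
    complex is functorial. *)
Lemma projective_acyclic (P : lmodType S) i (z : Kz n P) : projective P ->
  Kin i.+1 (fun=> True) z -> dK (xvar D n) z = 0 ->
  exists2 w : Kz n P, Kin i.+2 (fun=> True) w & dK (xvar D n) w = z.
Proof.
move=> projP zi dz.
have [h hE] := projP _ P (@free_cover S P) idfun (@free_cover_surj S P).
have lin (M N : lmodType S) (f : {linear M -> N}) m (u : Kz m M) :
    Kmap f (dK (xvar D n) u) = dK (xvar D n) (Kmap f u).
  by apply: Kmap_dK => [|j v _]; [exact: linearD | exact: linearZ].
have [||w wi wE] := free_acyclic (z := Kmap h z) (i := i) _ _.
- by apply: (Kin_Kmap (P := fun=> True)) zi => //; exact: linear0.
- by rewrite -lin dz Kmap0 //; exact: linear0.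
exists (Kmap (@free_cover S P) w).
  by apply: (Kin_Kmap (P := fun=> True)) wi => //; exact: linear0.
by rewrite -lin wE; apply: Kmap_cancel.
Qed.
End ProjectiveAcyclic.

Section KoszulResolution.
Variables (D : comNzRingType) (n : nat).
Local Notation S := {mpoly D[n]}.
Local Notation dX := (dK (xvar D n)).
Variables (N : lmodType S) (M : nat -> lmodType S) (Rs : resolution N M).
Local Notation dM := (res_d Rs).
Local Notation aug := (res_aug Rs).

Lemma Kmap_lin_dK (A B : lmodType S) (f : {linear A -> B}) m (u : Kz m A) :
  Kmap f (dX u) = dX (Kmap f u).
Proof. by apply: Kmap_dK => [|j v _]; [exact: linearD | exact: linearZ]. Qed.

Lemma Kmap_linB (A B : lmodType S) (f : {linear A -> B}) m (u v : Kz m A) :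
  Kmap f (u - v) = Kmap f u - Kmap f v.
Proof.
rewrite Kmap_additive; last exact: linearD.
by rewrite -scaleN1r (KmapZ (c' := -1)) ?scaleN1r // => w; rewrite linearZ.
Qed.

Lemma Kmap_lin0 (A B : lmodType S) (f : {linear A -> B}) m : Kmap f (0 : Kz m A) = 0.
Proof. by apply: Kmap0; exact: linear0. Qed.

Lemma Kz_lift (A B C : lmodType S) (f : {linear A -> B}) (g : {linear B -> C}) m (z : Kz m B) :
  (forall v, g v = 0 -> exists u, v = f u) -> Kmap g z = 0 -> exists w : Kz m A, z = Kmap f w.
Proof.
move=> gf; elim: m z => [|m IH] z /=; first exact: gf.
case: z => a b [] /IH [u ->] /IH [v ->]; by exists (u, v).
Qed.

Lemma Kz_surj (A B : lmodType S) (f : A -> B) m (z : Kz m B) :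
  (forall v, exists u, f u = v) -> exists w : Kz m A, Kmap f w = z.
Proof.
move=> fS; elim: m z => [|m IH] z /=; first exact: fS.
by case: z => a b; have [u <-] := IH a; have [v <-] := IH b; exists (u, v).
Qed.

Lemma Kin_exact (A B C : lmodType S) (f : {linear A -> B}) (g : {linear B -> C}) m i (z : Kz m B) :
  (forall v, g v = 0 -> exists u, v = f u) -> Kin i (fun=> True) z -> Kmap g z = 0 ->
  exists2 w : Kz m A, Kin i (fun=> True) w & Kmap f w = z.
Proof.
move=> gf zi gz; apply: (Kin_lift (P := fun v => True /\ g v = 0)).
- exact: linear0.
- by move=> v [_ /gf [u ->]]; exists u.
- exact: Kin_ker.
Qed.

Lemma res_dd i x : dM i (dM i.+1 x) = 0.
Proof. by apply/(res_exactS Rs); exists x. Qed.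

Lemma aug_d x : aug (dM 0 x) = 0.
Proof. by apply/(res_exact0 Rs); exists x. Qed.

Lemma Kmap_comp0 (A B C : lmodType S) (f : {linear A -> B}) (g : {linear B -> C}) m (z : Kz m A) :
  (forall x, g (f x) = 0) -> Kmap g (Kmap f z) = 0.
Proof. by move=> gf; elim: m z => [|m IH] //= -[a b]; rewrite !IH. Qed.

Section FiniteLength.
Variable p : nat.
Hypothesis projM : forall i, projective (M i).
Hypothesis M0 : forall i, (p < i)%N -> forall x : M i, x = 0.

Lemma resolution_cycle r s j (y : Kz n (M s.+1)) :
  (p <= s + r)%N -> (p <= j + s)%N -> Kin j (fun=> True) y -> Kmap (dM s) (dX y) = 0 ->
  exists (z : Kz n (M s.+1)) (z' : Kz n (M s.+2)),
    [/\ Kin j.+1 (fun=> True) z, Kin j (fun=> True) z' & y = dX z + Kmap (dM s.+1) z'].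
Proof.
have zeroK s' m (y' : Kz m (M s'.+1)) : (p <= s')%N -> y' = 0.
  by move=> ps; elim: m y' => [|m IH] y' //=; [apply: M0 | case: y' => a b; rewrite (IH a) (IH b)].
elim: r s j y => [|r IH] s j y psr pjs yj dy.
  have ps : (p <= s)%N by rewrite addn0 in psr.
  exists 0, 0; split; [exact: Kin0 | exact: Kin0 |].
  by rewrite dK0 Kmap_lin0 addr0; apply: zeroK.
have [ps|sp] := leqP p s.
  exists 0, 0; split; [exact: Kin0 | exact: Kin0 |].
  by rewrite dK0 Kmap_lin0 addr0; apply: zeroK.
case: j pjs yj => [|j] pjs yj; first by move: sp; rewrite ltnNge pjs.
have dyj : Kin j (fun=> True) (dX y) by apply: (Kin_dK (P := fun=> True)) yj.
have [|y' yj' yE] := Kin_exact (f := dM s.+1) _ dyj dy; first by move=> v /(res_exactS Rs).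
have [|||z [z' [zj zj' zE]]] := IH s.+1 j y' _ _ yj'.
- by rewrite addSnnS.
- by rewrite addnS -addSn.
- by rewrite Kmap_lin_dK yE dK_dK.
have dyz : dX (y - Kmap (dM s.+1) z) = 0.
  rewrite dKB -yE zE (Kmap_additive (linearD _)) -Kmap_lin_dK.
  by rewrite Kmap_comp0 ?addr0 ?subrr // => x; apply: res_dd.
have zT : Kin j.+1 (fun=> True) (Kmap (dM s.+1) z).
  by apply: (Kin_Kmap (P := fun=> True)) zj => //; exact: linear0.
have [|z2 z2j z2E] := projective_acyclic (@projM _) _ dyz (i := j).
  exact: KinB.
by exists z2, z; split=> //; rewrite z2E subrK.
Qed.

(** Lifting [x] along the augmentation starts the chase of [resolution_cycle]. It corrects the lift,
    by a term that the augmentation kills, to a true cycle over [M 0], which is a boundary. *)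
Lemma resolution_vanish i (x : Kz n N) : (p <= i)%N -> Kin i.+1 (fun=> True) x -> dX x = 0 ->
  exists2 y : Kz n N, Kin i.+2 (fun=> True) y & dX y = x.
Proof.
move=> pi xi dx.
have [y0 y0i y0E] : exists2 y0 : Kz n (M 0), Kin i.+1 (fun=> True) y0 & Kmap aug y0 = x.
  apply: Kin_lift xi => [|v _]; first exact: linear0.
  by have [u uE] := res_aug_surj Rs v; exists u.
have dyi : Kin i (fun=> True) (dX y0) by apply: (Kin_dK (P := fun=> True)) y0i.
have [||y1 y1i y1E] := Kin_exact (f := dM 0) (g := aug) _ dyi.
- by move=> v /(res_exact0 Rs).
- by rewrite Kmap_lin_dK y0E.
have [||||z [z' [zi zi' zE]]] := resolution_cycle (r := p) (s := 0) (j := i) (y := y1).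
- by [].
- by rewrite addn0.
- by [].
- by rewrite Kmap_lin_dK y1E dK_dK.
have dyz : dX (y0 - Kmap (dM 0) z) = 0.
  rewrite dKB -y1E zE (Kmap_additive (linearD _)) -Kmap_lin_dK.
  by rewrite Kmap_comp0 ?addr0 ?subrr // => u; apply: res_dd.
have zT : Kin i.+1 (fun=> True) (Kmap (dM 0) z).
  by apply: (Kin_Kmap (P := fun=> True)) zi => //; exact: linear0.
have [|z2 z2i z2E] := projective_acyclic (@projM _) _ dyz (i := i).
  exact: KinB.
exists (Kmap aug z2).
  by apply: (Kin_Kmap (P := fun=> True)) z2i => //; exact: linear0.
rewrite -Kmap_lin_dK z2E Kmap_linB y0E Kmap_comp0 ?subr0 //; exact: aug_d.
Qed.

End FiniteLength.

(* One leg of the zigzag in the double complex [Kz n (M j)] that identifies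
   the two ways of computing Tor. *)
Fixpoint zigzag j : Kz n (M j) -> Kz n (M 0) -> Prop :=
  match j with
  | 0 => fun w w0 => w = w0
  | j'.+1 => fun w w0 => exists2 w1 : Kz n (M j'), dX w1 = Kmap (dM j') w & zigzag w1 w0
  end.

Lemma zigzag_lin j c (v w : Kz n (M j)) v0 w0 :
  zigzag v v0 -> zigzag w w0 -> zigzag (c *: v + w) (c *: v0 + w0).
Proof.
elim: j v w => [|j IH] v w /=; first by move=> -> ->.
move=> [v1 v1E zv] [w1 w1E zw]; exists (c *: v1 + w1); last exact: IH.
rewrite dKD dKZ v1E w1E (Kmap_additive (linearD _)); congr (_ + _).
by rewrite (KmapZ (c' := c)) // => u; rewrite linearZ.
Qed.

(** Triviality travels back along the zigzag: if [w1 = dX a + dM b], then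
    [dM w = dX w1 = dM (dX b)], so by exactness [w - dX b] comes from the next term of the
    resolution. *)
Lemma zigzag_boundary j (w : Kz n (M j)) w0 : zigzag w w0 ->
  (exists x, Kmap aug w0 = dX x) ->
  exists (a : Kz n (M j)) (b : Kz n (M j.+1)), w = dX a + Kmap (dM j) b.
Proof.
move=> zw [x xE].
elim: j w zw => [|j IH] w /=.
  move=> ->; have [a aE] : exists a : Kz n (M 0), Kmap aug a = x.
    by apply: Kz_surj; exact: (res_aug_surj Rs).
  have [||b bE] := Kz_lift (f := dM 0) (g := aug) (z := w0 - dX a).
  - by move=> v /(res_exact0 Rs).
  - by rewrite Kmap_linB Kmap_lin_dK aE xE subrr.
  by exists a, b; rewrite -bE addrC subrK.
move=> [w1 w1E /IH [a [b abE]]].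
have [||b' bE] := Kz_lift (f := dM j.+1) (g := dM j) (z := w - dX b).
- by move=> v /(res_exactS Rs).
- by rewrite Kmap_linB -w1E Kmap_lin_dK abE dKD dK_dK add0r subrr.
by exists b, b'; rewrite -bE addrC subrK.
Qed.

End KoszulResolution.

Section QuotientVanish.
Variables (D : comNzRingType) (n : nat) (I : idealr {mpoly D[n]}).
Local Notation S := {mpoly D[n]}.
Local Notation Q := ({ideal_quot I} : lmodType S).

Lemma piD (u v : S) :
  \pi_({ideal_quot I}) (u + v) = \pi_({ideal_quot I}) u + \pi_({ideal_quot I}) v :> Q.
Proof. exact: rmorphD. Qed.

Lemma pi_eq0 (u : S) : (\pi_({ideal_quot I}) u = 0 :> Q) <-> u \in I.
Proof.
rewrite -[u in u \in I]subr0 Quotient.idealrBE; split=> [uE|/eqP uE].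
  by apply/eqP; rewrite uE rmorph0.
by rewrite uE rmorph0.
Qed.

Definition Kpi m : Kz m (reg S) -> Kz m Q :=
  Kmap (M := reg S) (N := Q) (\pi_({ideal_quot I}) : S -> _).

Lemma Kpi_dK m (z : Kz m (reg S)) : Kpi (dK (xvar D n) z) = dK (xvar D n) (Kpi z).
Proof.
apply: Kmap_dK => [|j u _]; first exact: piD.
exact: rmorphM.
Qed.

Lemma Kpi_eq0 m (z : Kz m (reg S)) i :
  Kin i (fun=> True) z -> Kpi z = 0 -> KinR i (fun f => f \in I) z.
Proof.
move=> zi /(Kin_ker zi); apply: Kin_sub => u [_ /pi_eq0]; exact.
Qed.

Lemma Kpi_in m (z : Kz m (reg S)) i : KinR i (fun f => f \in I) z -> Kpi z = 0.
Proof.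
move=> zI; rewrite /Kpi (Kmap_ext (g := fun=> 0) _ _ zI).
- by elim: (m) {zI} (z) => [|k IH] //= -[a b]; rewrite !IH.
- exact/pi_eq0/rpred0.
- by move=> u /pi_eq0.
Qed.

Lemma Kvanish_pdim p : projective_resolution_of_length Q p -> Kvanish p (fun f => f \in I).
Proof.
move=> [M [projM M0 [Rs]]] i z pi zi dz.
have pi0 : \pi_({ideal_quot I}) (0 : S) = 0 :> Q by exact: rmorph0.
have [||x xi xE] := resolution_vanish Rs projM M0 (x := Kpi z) pi.
- by apply: (Kin_Kmap (M := reg S) (N := Q) (P := fun=> True)) zi.
- by rewrite -Kpi_dK (Kpi_in dz).
have [w wi wE] : exists2 w : Kz n (reg S), Kin i.+2 (fun=> True) w & Kpi w = x.
  apply: Kin_lift xi => // v _; exists (repr v) => //; exact: reprK.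
exists w => //; apply: Kpi_eq0.
  by apply: KinB => //; apply: (Kin_dK (P := fun=> True)) wi.
rewrite /Kpi Kmap_additive; last exact: piD.
rewrite -/(Kpi _) -/(Kpi (- _)) -scaleN1r /Kpi (KmapZ (c' := -1)).
  by rewrite -/(Kpi _) -/(Kpi _) Kpi_dK wE xE scaleN1r subrr.
by move=> u; rewrite -[LHS]/(\pi_({ideal_quot I}) (_ * _)); exact: rmorphM.
Qed.
End QuotientVanish.

(** * From Tor to Koszul cycles *)

Fixpoint Kbot (R : comNzRingType) m (M : lmodType R) (u : M) : Kz m M :=
  if m is m'.+1 then (Kbot m' u, 0) else u.

Fixpoint Kbottom (R : comNzRingType) m (M : lmodType R) : Kz m M -> M :=
  if m is m'.+1 then fun z => Kbottom z.1 else id.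

(* [\sum_(j < m) h j e_j] *)
Fixpoint Kone (R : comNzRingType) m (M : lmodType R) (h : nat -> M) : Kz m M :=
  if m is m'.+1 then (Kone m' h, Kbot m' (h m')) else 0.

Section Bottom.
Variables (R : comNzRingType) (X : nat -> R) (M : lmodType R).

Lemma Kbot_lin m c (u v : M) : Kbot m (c *: u + v) = c *: Kbot m u + Kbot m v.
Proof.
elim: m => [|m IH] //=; rewrite IH; congr pair.
exact: (esym (etrans (addr0 _) (scaler0 _ c))).
Qed.

Lemma Kin_bot m (P : M -> Prop) u : P u -> Kin 0 P (Kbot m u).
Proof. by elim: m => [|m IH] //= Pu; split=> //; apply: IH. Qed.

Lemma Kin_one m (P : M -> Prop) h : P 0 -> (forall j, (j < m)%N -> P (h j)) ->
  Kin 1 P (Kone m h).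
Proof.
move=> P0; elim: m => [|m IH] //= Ph; split; last by apply: Kin_bot; apply: Ph.
by apply: IH => j jm; apply: Ph; apply: ltnW.
Qed.

Lemma dK_bot m (u : M) : dK X (Kbot m u) = 0.
Proof. exact: Kin_dK0 (@Kin_bot m (fun=> True) u Logic.I). Qed.

Lemma dK_one m h : dK X (Kone m h : Kz m M) = Kbot m (\sum_(j < m) X j *: h j).
Proof.
elim: m => [|m IH] /=; first by rewrite big_ord0.
rewrite IH dK_bot oppr0; congr pair; rewrite big_ord_recr /= addrC Kbot_lin.
exact: addrC.
Qed.

Lemma KbotK m (u : M) : Kbottom (Kbot m u) = u.
Proof. by elim: m => [|m IH] //=. Qed.

Lemma KbottomD m (u v : Kz m M) : Kbottom (u + v) = Kbottom u + Kbottom v.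
Proof. by elim: m u v => [|m IH] //= u v; rewrite IH. Qed.

Lemma KbottomZ m c (u : Kz m M) : Kbottom (c *: u) = c *: Kbottom u.
Proof. by elim: m u => [|m IH] //= u; rewrite IH. Qed.

Lemma Kbottom_dK m (u : Kz m M) : exists h : nat -> M,
  Kbottom (dK X u) = \sum_(j < m) X j *: h j.
Proof.
elim: m u => [|m IH] u /=; first by exists (fun=> 0); rewrite big_ord0.
have [h hE] := IH u.1; exists (fun j => if j == m then Kbottom u.2 else h j).
rewrite KbottomD KbottomZ hE big_ord_recr /= eqxx; congr (_ + _).
by apply: eq_bigr => j _; rewrite ltn_eqF.
Qed.
End Bottom.

Lemma Kmap_bot (R : comNzRingType) (M N : lmodType R) (f : {linear M -> N}) m u :
  Kmap f (Kbot m u) = Kbot m (f u).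
Proof. by elim: m => [|m IH] //=; rewrite IH Kmap0 //; exact: linear0. Qed.

Lemma Kbottom_Kmap (R R' : comNzRingType) (M : lmodType R) (N : lmodType R') (f : M -> N) m
  (z : Kz m M) : Kbottom (Kmap f z) = f (Kbottom z).
Proof. by elim: m z => [|m IH] //= z; rewrite IH. Qed.

Section MaximalIdeal.
Variables (D : comNzRingType) (n : nat).
Local Notation S := {mpoly D[n]}.

Fixpoint set_vars0 m (f : S) : S := if m is m'.+1 then setX0 m' (set_vars0 m' f) else f.

Definition quot_var j (f : S) : S := divX j (set_vars0 j f).

Lemma set_vars0_decomp m (f : S) : (m <= n)%N ->
  f = set_vars0 m f + \sum_(j < m) xvar D n j * quot_var j f.
Proof.
elim: m => [|m IH] mn; first by rewrite big_ord0 addr0.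
rewrite big_ord_recr /= {1}(IH (ltnW mn)) {1}(setX0_decomp (set_vars0 m f) mn).
by rewrite -addrA [X in _ + X]addrC addrA.
Qed.

Lemma mcoeff_set_vars0 m f a : (m <= n)%N -> (set_vars0 m f)@_a != 0 ->
  forall j : 'I_n, (j < m)%N -> a j = 0%N.
Proof.
elim: m => [|m IH] mn //= fa j; rewrite ltnS leq_eqVlt => /orP[/eqP jm|jm].
  by move: fa; rewrite -jm mcoeff_setX0; case: (a j =P 0%N) => // _; rewrite eqxx.
apply: IH (ltnW mn) _ j jm; move: fa; rewrite -[m]/(val (Ordinal mn)) mcoeff_setX0.
by case: ifP => //; rewrite eqxx.
Qed.

Lemma set_vars0_coeff0 m f : (m <= n)%N -> (set_vars0 m f)@_0%MM = f@_0%MM.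
Proof.
elim: m => [|m IH] mn //=.
by rewrite -[m in setX0 m]/(val (Ordinal mn)) mcoeff_setX0 mnm0E eqxx IH // ltnW.
Qed.

Lemma degs_set_vars0 Q m f : (m <= n)%N -> degs Q f -> degs Q (set_vars0 m f).
Proof.
move=> mn Qf; elim: m mn => [|m IH] mn //=.
by apply: degs_setX0 => //; apply: IH; apply: ltnW.
Qed.

Lemma degs_quot_var Q j f : (j < n)%N -> degs Q f -> degs (fun e => Q e.+1) (quot_var j f).
Proof. by move=> jn Qf; apply: degs_divX => //; apply: degs_set_vars0 => //; apply: ltnW. Qed.

Lemma maximal_decomp f : f@_0%MM = 0 -> f = \sum_(j < n) xvar D n j * quot_var j f.
Proof.
move=> f0; rewrite {1}(set_vars0_decomp f (leqnn n)).
suff -> : set_vars0 n f = 0 by rewrite add0r.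
apply/mpolyP => a; rewrite mcoeff0; apply/eqP/negPn/negP => fa.
have a0 : a = 0%MM.
  by apply/mnmP => j; rewrite mnm0E; apply: (mcoeff_set_vars0 _ fa).
by move: fa; rewrite a0 set_vars0_coeff0 // f0 eqxx.
Qed.

Lemma xvar_sum_coeff0 m (h : nat -> S) : (\sum_(j < m) xvar D n j * h j)@_0%MM = 0.
Proof.
rewrite raddf_sum big1 //= => j _; have [jn|nj] := ltnP j n.
  by rewrite -[nat_of_ord j]/(val (Ordinal jn)) xvarE mcoeffXM mnm0E eqxx.
by rewrite xvar_out // mul0r mcoeff0.
Qed.

End MaximalIdeal.

(** * From Tor classes to Koszul chains of bounded degree *)

Section GradedResolution.
Variables (k : fieldType) (n : nat) (I : idealr {mpoly k[n]}).
Variable F : graded_free_resolution I.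
Local Notation S := {mpoly k[n]}.
Local Notation M i := ('rV[S]_(rk F i) : lmodType S).
Local Notation dF := (res_d F).
Local Notation aug := (res_aug F).
Local Notation dX := (dK (xvar k n)).

(** Only an upper bound on degrees in [F_i] is tracked; the matching lower bound comes at the end,
    from [I] having nothing in degrees below [d]. *)
Definition filt i (e : int) (v : M i) :=
  forall b, degs (fun a : nat => a%:Z <= e - gdeg b) (v 0 b).

Lemma homog_int_degs z (f : S) : homog_int z f -> degs (fun a : nat => a%:Z = z) f.
Proof.
case: z => [e|e] /= => [fe m fm|/eqP -> m]; last by rewrite mcoeff0 eqxx.
by congr Posz; apply: (dhomogP _ _ _ fe); rewrite mcoeff_msupp.
Qed.

Lemma dF_expand i (v : M i.+1) b :
  (dF i v) 0 b = \sum_a v 0 a * (dF i (delta_mx 0 a)) 0 b.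
Proof.
rewrite {1}(row_sum_delta v) linear_sum summxE; apply: eq_bigr => a _.
by rewrite linearZ mxE.
Qed.

Lemma filt_dF i e (v : M i.+1) : filt e v -> filt e (dF i v).
Proof.
move=> ve b; rewrite dF_expand; apply: degs_sum => a _.
apply: degsM (ve a) (homog_int_degs (gd_homog a b)) => x y xa yE.
by rewrite PoszD yE; move: xa; lia.
Qed.

Lemma filt_exact i j e (z : Kz n (M i)) :
  Kin j.+1 (@filt i e) z -> dX z = 0 ->
  exists2 w : Kz n (M i), Kin j.+2 (@filt i (e - 1)) w & dX w = z.
Proof.
move=> zj dz.
apply: (@coord_exact k n (M i) 'I_(rk F i) (fun b v => v 0 b) (fun t v => map_mx t v)
  _ _ _ _ (fun e b a => a%:Z <= e - gdeg b)) dz => //.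
- by move=> a u v; rewrite mxE.
- by move=> a s u; rewrite mxE.
- by move=> u v uv; apply/rowP.
- by move=> t a u _; rewrite mxE.
- by move=> e' a b; lia.
Qed.

Definition zigzag_cond j : Kz n (M j) -> Prop :=
  match j with
  | 0 => fun w => Kmap aug (dX w) = 0
  | j'.+1 => fun w => Kmap (dF j') (dX w) = 0
  end.

Lemma zigzag_condP j (w : Kz n (M j.+1)) (w1 : Kz n (M j)) :
  dX w1 = Kmap (dF j) w -> zigzag_cond w1.
Proof.
case: j w w1 => [|j] w w1 /= ->; apply: Kmap_comp0; first exact: aug_d.
exact: res_dd.
Qed.

(** Each leg applies a map of degree 0 and then [filt_exact], which raises the exterior degree by
    one and lowers the bound by one; hence the shift by [j]. *)
Lemma zigzag_exists j s e (w : Kz n (M j)) : Kin s.+1 (@filt j e) w ->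
  zigzag_cond w ->
  exists w0, [/\ Kin (s.+1 + j) (@filt 0 (e - j%:Z)) w0, zigzag F w w0 & Kmap aug (dX w0) = 0].
Proof.
elim: j s e w => [|j IH] s e w we dw.
  by exists w; split; rewrite ?addn0 ?subr0.
have dwe : Kin s.+1 (@filt j e) (Kmap (dF j) w).
  by apply: Kin_Kmap we => [|u]; [exact: linear0 | exact: filt_dF].
have [|w1 w1e w1E] := filt_exact dwe; first by rewrite -Kmap_lin_dK.
have [|w0 [w0e w0z w0d]] := IH _ _ _ w1e.
  exact: zigzag_condP w1E.
exists w0; split=> //; last by exists w1.
rewrite addnS -addSn.
suff -> : e - j.+1%:Z = e - 1 - j%:Z by [].
by lia.
Qed.

Lemma aug_lift : exists f : 'I_(rk F 0) -> S,
  forall b, degs (fun a : nat => a%:Z = gdeg b) (f b) /\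
    aug (delta_mx 0 b) = \pi_({ideal_quot I}) (f b).
Proof.
apply: (fin_all_exists (P := fun b f => degs (fun a : nat => a%:Z = gdeg b) f /\
    aug (delta_mx 0 b) = \pi_({ideal_quot I}) f)) => b.
by have [f fh fE] := gaug_homog b; exists f; split=> //; apply: homog_int_degs.
Qed.

Definition const_row i (v : 'rV[k]_(rk F i)) : M i := map_mx (@mpolyC n k) v.

Definition row_const i (v : M i) : 'rV[k]_(rk F i) := map_mx (fun f : S => f@_0%MM) v.

Lemma const_rowK i v : row_const (@const_row i v) = v.
Proof. by apply/rowP => b; rewrite !mxE mcoeffC eqxx mulr1. Qed.

Lemma row_const_dF i (v : M i.+1) : row_const (dF i v) = row_const v *m kd F i.
Proof.
apply/rowP => b; rewrite !mxE dF_expand raddf_sum /=; apply: eq_bigr => a _.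
by rewrite !mxE; exact: (rmorphM (mcoeff 0%MM)).
Qed.

Lemma kd_kd i : kd F i.+1 *m kd F i = 0.
Proof.
apply/row_matrixP => a; rewrite row_mul row0.
have -> : row a (kd F i.+1) = row_const (dF i.+1 (delta_mx 0 a)) by apply/rowP => b; rewrite !mxE.
by rewrite -row_const_dF res_dd; apply/rowP => b; rewrite !mxE mcoeff0.
Qed.

Section TorToCycle.
Variables (d t : nat).
Local Notation J := ((d + t)%:Z).

Definition aug_poly (f : 'I_(rk F 0) -> S) (x : M 0) : reg S := \sum_b x 0 b * f b.

(* The class of [v] in [H_(t+1)(k (x) F)] corresponds to that of [u] in the
   Koszul homology [H_(t+1)(x; S/I)]. *)
Definition tor_rel (f : 'I_(rk F 0) -> S) (v : 'rV[k]_(rk F t.+1)) (u : Kz n (reg S)) :=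
  exists2 w0 : Kz n (M 0), zigzag F (Kbot n (const_row v)) w0 &
    Kmap (aug_poly f) w0 = u.

Variable f : 'I_(rk F 0) -> S.
Hypothesis fP : forall b, degs (fun a : nat => a%:Z = gdeg b) (f b) /\
    aug (delta_mx 0 b) = \pi_({ideal_quot I}) (f b).

Local Notation E := (aug_poly f).

Lemma aug_polyE x : aug x = \pi_({ideal_quot I}) (E x).
Proof.
rewrite {1}(row_sum_delta x) linear_sum /aug_poly raddf_sum; apply: eq_bigr => b _.
by rewrite linearZ (proj2 (fP b)) /= rmorphM.
Qed.

Lemma aug_polyD x y : E (x + y) = E x + E y.
Proof. by rewrite /aug_poly -big_split; apply: eq_bigr => b _; rewrite mxE mulrDl. Qed.

Lemma aug_polyZ c x : E (c *: x) = c *: E x.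
Proof.
rewrite -[RHS]/(c * _) /aug_poly mulr_sumr; apply: eq_bigr => b _.
by rewrite mxE mulrA.
Qed.

Lemma aug_poly0 : E 0 = 0.
Proof. by rewrite /aug_poly big1 // => b _; rewrite mxE mul0r. Qed.

Lemma Kmap_aug_poly_dK m (z : Kz m (M 0)) : Kmap E (dX z) = dX (Kmap E z).
Proof. by apply: Kmap_dK => [|j u _]; [exact: aug_polyD | exact: aug_polyZ]. Qed.

Lemma Kpi_aug_poly m (z : Kz m (M 0)) : Kpi I (Kmap E z) = Kmap aug z.
Proof. by elim: m z => [|m IH] /= z; [rewrite aug_polyE | rewrite -!IH]. Qed.

Lemma tor_rel_lin c v w u x : tor_rel f v u -> tor_rel f w x ->
  tor_rel f (c *: v + w) (c%:MP *: u + x).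
Proof.
move=> [v0 zv <-] [w0 zw <-]; exists (c%:MP *: v0 + w0).
  have -> : Kbot n (const_row (c *: v + w)) =
      c%:MP *: Kbot n (const_row v) + Kbot n (const_row w).
    rewrite -Kbot_lin; congr Kbot; apply/rowP => b.
    by rewrite !mxE mpolyCD mpolyCM.
  exact: zigzag_lin.
rewrite -/aug_poly (Kmap_additive aug_polyD); congr (_ + _).
by rewrite (KmapZ (c' := c%:MP)) // => y; apply: aug_polyZ.
Qed.

(** The Koszul complex of [S] is exact in positive exterior degree, so the cycle [u] is a boundary
    and its class over [S/I] is trivial; [zigzag_boundary] carries this back to [v]. Taking constant
    terms in exterior degree 0 kills the [dX] part and leaves a combination of rows of [kd]. *)
Lemma tor_rel_boundary v u : tor_rel f v u -> Kin t.+1 (fun=> True) u -> dX u = 0 ->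
  (v <= kd F t.+1)%MS.
Proof.
move=> [w0 zw w0E] ut du.
have [u' _ u'E] : exists2 u' : Kz n (reg S), Kin t.+2 (fun=> True) u' & dX u' = u.
  have [|||||||w wi wE] := @coord_exact k n (reg S) unit (fun _ u => u) id
    _ _ _ _ (fun _ _ _ => True) _ n t 0 u _ _ du => //.
  - by move=> x y xy; apply: (xy tt).
  - by apply: Kin_sub ut.
  by exists w => //; apply: Kin_sub wi.
have [|a [b abE]] := zigzag_boundary zw.
  by exists (Kpi I u'); rewrite -Kpi_aug_poly w0E -u'E Kpi_dK.
have /(congr1 (fun z => row_const (Kbottom z))) := abE.
rewrite KbotK const_rowK KbottomD Kbottom_Kmap.
have [h ->] := Kbottom_dK (xvar k n) a.
have -> x y : @row_const t.+1 (x + y) = row_const x + row_const y.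
  by apply/rowP => c; rewrite !mxE mcoeffD.
rewrite row_const_dF => ->.
have -> : row_const (\sum_(j < n) xvar k n j *: h j : M t.+1) = 0.
  apply/rowP => c; rewrite !mxE summxE.
  under eq_bigr do rewrite mxE.
  exact: (xvar_sum_coeff0 n (fun j => h j 0 c)).
by rewrite add0r submxMl.
Qed.

(** Since [v] is a cycle, [W] has no constant terms, so [W = \sum_j x_j h_j] and the zigzag starts
    in exterior degree 1 at level [t]. The bound [d + t] drops by one there and by one on each of
    the [t] legs, which leaves [d - 1]. *)
Lemma tor_rel_exists v : v *m kd F t = 0 ->
  (forall b, v 0 b != 0 -> gdeg b <= J) ->
  exists u, [/\ tor_rel f v u, KinR t.+1 (fun g => degs (fun a : nat => a%:Z <= d%:Z - 1) g) u &
     KinR t (fun g => g \in I) (dX u)].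
Proof.
move=> vk vJ.
pose V := const_row v; pose W := dF t V.
have Ve : filt J V.
  move=> b m; rewrite mxE mcoeffC.
  case: (m =P 0%MM) => [->|_]; last by rewrite mulr0 eqxx.
  by rewrite mulr1 mdeg0 subr_ge0 => /vJ.
have We : filt J W by apply: filt_dF.
have W0 b : (W 0 b)@_0%MM = 0.
  have /rowP/(_ b) : row_const W = 0 by rewrite row_const_dF const_rowK.
  by rewrite !mxE.
pose h j : M t := map_mx (@quot_var k n j) W.
have WE : W = \sum_(j < n) xvar k n j *: h j.
  apply/rowP => b; rewrite summxE {1}(maximal_decomp (W0 b)).
  by apply: eq_bigr => j _; rewrite !mxE.
have zero_filt i e : @filt i e 0.
  by move=> b; rewrite mxE; case: (degs_zclosed k n (fun a : nat => a%:Z <= e - gdeg b)).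
have w1e : Kin 1 (@filt t (J - 1)) (Kone n h).
  apply: Kin_one => [|j jn b]; first exact: zero_filt.
  by rewrite mxE; apply: degs_sub (degs_quot_var jn (We b)) => a; lia.
have w1E : dX (Kone n h) = Kmap (dF t) (Kbot n V).
  by rewrite dK_one -WE Kmap_bot.
have [|w0 [w0e zw dw0]] := zigzag_exists w1e.
  exact: zigzag_condP w1E.
exists (Kmap E w0); split.
- by exists w0 => //; exists (Kone n h).
- rewrite add1n in w0e; apply: Kin_Kmap w0e => [|x xe]; first exact: aug_poly0.
  apply: degs_sum => b _; apply: degsM (xe b) (proj1 (fP b)) => a a' aE a'E.
  by rewrite PoszD a'E; move: aE; lia.
have w0T : Kin t.+1 (fun=> True) w0 by apply: Kin_sub w0e.
apply: Kpi_eq0.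
  apply: (Kin_dK (P := fun=> True)) => //.
  by apply: (Kin_Kmap (P := fun=> True)) w0T => //; exact: aug_poly0.
by rewrite -Kmap_aug_poly_dK Kpi_aug_poly.
Qed.

End TorToCycle.

End GradedResolution.

Section Truncation.
Variables (k : fieldType) (n : nat) (I : idealr {mpoly k[n]}).
Variable F : graded_free_resolution I.

Lemma kd_degree i a b : kd F i a b != 0 -> gdeg a = gdeg b.
Proof.
rewrite mxE => /(homog_int_degs (gd_homog a b)).
by rewrite mdeg0 => /esym/eqP; rewrite subr_eq0 => /eqP.
Qed.

Lemma kd_kdegree i j : kd F i *m kdegree F i j = kdegree F i.+1 j *m kd F i.
Proof.
have := @kd_degree i; move: (kd F i) => K Kdeg.
apply/matrixP => a b; rewrite /kdegree mul_mx_diag mul_diag_mx !mxE mulrC.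
have [->|/Kdeg ab] := eqVneq (K a b) 0; first by rewrite !mulr0.
by rewrite ab.
Qed.

Lemma kd_sub_kcycles t : (kd F t.+1 <= kcycles F t.+1)%MS.
Proof. by apply/sub_kermxP; exact: kd_kd. Qed.

Lemma kcycles_kdegree t j (v : 'rV_(rk F t.+1)) : (v <= kcycles F t.+1)%MS ->
  (v *m kdegree F t.+1 j <= kcycles F t.+1)%MS.
Proof.
by move=> /sub_kermxP vk; apply/sub_kermxP; rewrite -mulmxA -kd_kdegree mulmxA vk mul0mx.
Qed.

(** [graded_betti] is a truncated difference, so its vanishing only compares ranks; as boundaries
    are cycles, this forces the two intersections to agree. *)
Lemma graded_betti0 t j (v : 'rV_(rk F t.+1)) : graded_betti F t.+1 j = 0%N ->
  (v <= kcycles F t.+1)%MS -> (v *m kdegree F t.+1 j <= kd F t.+1)%MS.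
Proof.
move=> /eqP; rewrite subn_eq0 => rank_le vk.
have sub : (kd F t.+1 :&: kdegree F t.+1 j <= kcycles F t.+1 :&: kdegree F t.+1 j)%MS.
  exact: capmxS (kd_sub_kcycles t) (submx_refl _).
have /leqifP := mxrank_leqif_sup sub; case: ifPn => [csub _|_]; last by rewrite ltnNge rank_le.
apply: submx_trans (capmxSl _ (kdegree F t.+1 j)); apply: submx_trans csub.
by rewrite sub_capmx kcycles_kdegree // submxMl.
Qed.

(* Tor vanishes in degrees [> J], so every class has a representative supported
   on basis elements of degree [<= J]. *)
Lemma truncate_cycle t (J : int) (v : 'rV_(rk F t.+1)) :
  (forall j, J < j -> graded_betti F t.+1 j = 0%N) ->
  (v <= kcycles F t.+1)%MS ->
  exists s : 'rV_(rk F t.+1), [/\ (s <= kcycles F t.+1)%MS,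
    forall b, s 0 b != 0 -> gdeg b <= J & (v - s <= kd F t.+1)%MS].
Proof.
move=> bJ vk; pose js := undup [seq gdeg b | b : 'I_(rk F t.+1)].
pose part P := \sum_(j <- js | P j) v *m kdegree F t.+1 j.
have partE P b : part P 0 b = if P (gdeg b) then v 0 b else 0.
  rewrite /part summxE big_mkcond /=.
  have bjs : gdeg b \in js by rewrite mem_undup map_f ?mem_enum.
  rewrite (bigD1_seq (gdeg b)) ?undup_uniq //= big1 => [|j jb].
    by rewrite addr0; case: ifP => // _; rewrite mul_mx_diag !mxE eqxx mulr1.
  by case: ifP => // _; rewrite mul_mx_diag !mxE eq_sym (negPf jb) mulr0.
exists (part (fun j => j <= J)); split.
- by apply: summx_sub => j _; apply: kcycles_kdegree.
- by move=> b; rewrite partE; case: ifP; rewrite ?eqxx.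
have -> : v - part (fun j => j <= J) = part (fun j => J < j).
  by apply/rowP => b; rewrite !mxE !partE ltNge; case: ifP; rewrite ?subrr ?subr0.
by apply: summx_sub => j Jj; apply: graded_betti0 => //; apply: bJ.
Qed.
End Truncation.

Lemma generated_degs (k : fieldType) n (I : idealr {mpoly k[n]}) d :
  generated_in_degree I d -> forall f, f \in I -> degs (leq d) f.
Proof.
move=> gI f /gI [m [a [g [gP ->]]]]; apply: degs_sum => l _.
apply: (degsM (Q := fun=> True) (Q' := eq d)) => [x y _ <-||].
- exact: leq_addl.
- by [].
move=> x gx; symmetry; apply: (dhomogP _ _ _ (proj2 (gP l))).
by rewrite mcoeff_msupp.
Qed.

Lemma ideal_var_stable (k : fieldType) n (I : idealr {mpoly k[n]}) :
  var_stable (fun f => f \in I) /\ scaled (fun f => f \in I).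
Proof.
split; last by move=> c f; apply: idealMr.
do ?split; [exact: rpred0 | by move=> u v ? ?; apply: rpredB | by move=> j f; apply: idealMr].
Qed.

Theorem corollary3p11 (k : fieldType) (n : nat) (I : idealr {mpoly k[n]})
    (F : graded_free_resolution I) (c p d q : nat) :
  homogeneous_ideal I ->
  ideal_height I c -> (2 <= c)%N ->
  pdim ({ideal_quot I} : lmodType {mpoly k[n]}) p ->
  (1 <= d)%N -> (1 <= q)%N ->
  condition_N F d q ->
  forall t : nat, (2 <= t <= q)%N ->
    (betti F t <= 'C(d + t - 2, t - 1) * 'C(d + p - 1, p - t))%N.
Proof.
move=> _ _ _ [resP _] d0 _ [gI tN] [|t] // /andP[_ tq].
have Id := generated_degs gI; have [subI scI] := ideal_var_stable I.
have KV := Kvanish_pdim resP.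
(* The index is now [t.+1], so the linear degree [d + i - 1] reads [d + t]. *)
have bJ j : (d + t)%:Z < j -> graded_betti F t.+1 j = 0%N.
  move=> Jj; apply/eqP/negPn/negP => /eqP b0.
  have [|/(_ _ b0) + _] := tN t.+1; first by rewrite tq.
  by rewrite addnS subn1 /= leNgt Jj.
apply: (@leq_trans ('C(d + t - 1, t) * 'C(d + p - 1, d + t))%N); last first.
  rewrite addnS subSS !subn1 /= leq_mul2l; apply/orP; right.
  (* The subtraction [p - t.+1] is truncated: for [p <= t] the binomial on the right is 1 and the
     one on the left is 0. Otherwise they agree by symmetry. *)
  have [tp|pt] := ltnP t p; last by rewrite bin_small //; lia.
  by rewrite -[X in (_ <= X)%N]bin_sub; [apply/eq_leq; congr binomial; lia | lia].
rewrite leqNgt; apply/negP => bound.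
(* The rows of [B] span a complement of the boundaries in the cycles, so they represent independent
   Tor classes. *)
pose B := row_base (kcycles F t.+1 :\: kd F t.+1)%MS.
have {}bound : ('C(d + t - 1, t) * 'C(d + p - 1, d + t)
    < \rank (kcycles F t.+1 :\: kd F t.+1)%MS)%N.
  apply: leq_trans bound _; rewrite /betti leq_subLR.
  by rewrite -(mxrank_cap_compl (kcycles F t.+1) (kd F t.+1)) leq_add2r mxrankS ?capmxSr.
have Bk l : (row l B <= kcycles F t.+1)%MS.
  apply: submx_trans (row_sub _ _) _; rewrite eq_row_base; exact: diffmxSl.
have [s /all_and3[sk sJ sB]] := fin_all_exists (fun l => truncate_cycle bJ (Bk l)).
have [f fP] := aug_lift F.
have uP l : exists u, [/\ tor_rel f (s l) u,
    KinR t.+1 (fun g => degs (fun a : nat => a%:Z <= d%:Z - 1) g) u &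
    KinR t (fun g => g \in I) (dK (xvar k n) u)].
  have /sub_kermxP sl := sk l.
  by apply: (tor_rel_exists fP sl) => b; apply: sJ.
have [u /all_and3[su ud uI]] := fin_all_exists uP.
have cyc_u l : lin_cycle (fun g => g \in I) d t (dK (xvar k n) (u l)).
  split; last exact: dK_dK.
  have ud1 : KinR t (fun g => degs (fun a : nat => a%:Z <= d%:Z) g) (dK (xvar k n) (u l)).
    apply: (Kin_dK _ _ (ud l)); first exact: degs_zclosed.
    move=> j g _ gd; rewrite -[_ *: _]/(xvar k n j * g).
    by apply: degsM (@degs_xvar _ n j) gd => a a' <-; lia.
  (* Membership in [I] gives degree at least [d], and [ud1] gives at most [d]. *)
  apply: Kin_sub (Kin_and (uI l) ud1) => g [gI' gd]; split=> // m gm.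
  by have := Id _ gI' _ gm; have := gd _ gm; lia.
have [c0 [[l0 cl0] cE]] := cycles_dependent d0 subI scI Id KV cyc_u bound.
have sE : ((\sum_l c0 l *: s l)%R <= kd F t.+1)%MS.
  apply: (tor_rel_boundary (u := \sum_l (c0 l)%:MP *: u l) fP).
  - elim/big_rec2: _ => [|l y1 y2 _ tor]; last exact: tor_rel_lin.
    have := tor_rel_lin (-1) (su l0) (su l0).
    by rewrite mpolyCN mpolyC1 !scaleN1r !addNr.
  - apply: Kin_sum => // l; apply: (KinZ (P := fun=> True)) => //.
    by apply: Kin_sub (ud l).
  by rewrite dK_sum -[RHS]cE; apply: eq_bigr => l _; rewrite dKZ.
pose r := \row_l c0 l.
have rB : r *m B = \sum_l c0 l *: row l B.
  by rewrite mulmx_sum_row; apply: eq_bigr => l _; rewrite mxE.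
(* Modulo boundaries each row of [B] equals its truncation [s l], so the relation [c0] turns a
   combination of the rows of [B] into a boundary, against their independence. *)
have rBk : (r *m B <= kd F t.+1)%MS.
  have -> : r *m B = \sum_l c0 l *: (row l B - s l) + \sum_l c0 l *: s l.
    by rewrite rB -big_split; apply: eq_bigr => l _; rewrite /= -scalerDr subrK.
  by rewrite addmx_sub // summx_sub // => l _; rewrite scalemx_sub.
have rBd : (r *m B <= kcycles F t.+1 :\: kd F t.+1)%MS.
  by rewrite -(eq_row_base (kcycles F t.+1 :\: kd F t.+1)%MS) submxMl.
have rB0 : r *m B = 0.
  by apply/eqP; rewrite -submx0 -(capmx_diff (kcycles F t.+1) (kd F t.+1)) sub_capmx rBk rBd.
have r0 : r = 0.
  by apply: (row_free_inj (row_base_free (kcycles F t.+1 :\: kd F t.+1)%MS)); rewrite mul0mx.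
by have /rowP/(_ l0) := r0; rewrite !mxE => /eqP; rewrite (negPf cl0).
Qed.
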